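(* Let $\mathfrak{g}$ be the five-dimensional real Lie algebra with basis $\{e_1,\dots,e_5\}$ whose only nonzero brackets (up to skew-symmetry) are $$[e_1,e_2]=\sqrt2\,e_2-2e_5,\quad [e_2,e_3]=\sqrt2\,e_4,\quad [e_2,e_4]=-\sqrt2\,e_3,$$ $$[e_3,e_4]=-2e_5,\quad [e_3,e_5]=-e_4,\quad [e_4,e_5]=e_3,$$ endowed with the Sasakian structure $(\varphi,\xi,\eta,g)$ for which $\{e_1,\dots,e_5\}$ is $g$-orthonormal, $\xi=e_5$, $\eta(e_5)=1$, $\ker\eta=\operatorname{span}\{e_1,\dots,e_4\}$, $\varphi(e_1)=-e_2$, $\varphi(e_2)=e_1$, $\varphi(e_3)=-e_4$, $\varphi(e_4)=e_3$, $\varphi(e_5)=0$. Let $G$ be a connected Lie group with Lie algebra $\mathfrak{g}$ and denote again by $(\varphi,\xi,\eta,g)$ the associated left-invariant Sasakian structure on $G$. Then $\mathfrak{g}$ admits a $g$-orthogonal decomposition $$\mathfrak{g}=\mathfrak{d}_+\oplus\mathfrak{d}_-\oplus\mathbb{R}\xi$$ such that, for every real number $a>1$, the left-invariant metric $g_a$ on $G$ defined at the identity $e$ by $$(g_a)_e=\begin{cases}\frac1a\, g_e & \text{on }\mathfrak{d}_+\times\mathfrak{d}_+,\\ a\,g_e & \text{on }\mathfrak{d}_-\times\mathfrak{d}_-,\\ \eta_e\otimes\eta_e & \text{otherwise}\end{cases}$$ (where ''otherwise'' refers to the remaining pairs of summands of the decomposition) is also associated to the contact form $\eta$ and determines a contact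 metric $(k,\mu)$ structure on $G$, whose Boeckx invariant is $$I_a=-\frac{a^2+1}{a^2-1}.$$
   Context: The convention $2\,d\eta(X,Y)=X(\eta(Y))-Y(\eta(X))-\eta([X,Y])$ is used; for left-invariant objects $d\eta(X,Y)=-\frac12\eta([X,Y])$. A contact metric structure on an odd-dimensional manifold is a quadruple $(\varphi,\xi,\eta,g)$, with $\varphi$ a $(1,1)$-tensor field, $\xi$ a vector field, $\eta$ a 1-form and $g$ a Riemannian metric, such that $\eta(\xi)=1$, $\varphi^2=-\mathrm{Id}+\eta\otimes\xi$, $g(\varphi X,\varphi Y)=g(X,Y)-\eta(X)\eta(Y)$ and $g(X,\varphi Y)=d\eta(X,Y)$. It is Sasakian if moreover $N_\varphi=-2\,d\eta\otimes\xi$, where $N_\varphi(X,Y)=\varphi^2[X,Y]+[\varphi X,\varphi Y]-\varphi[\varphi X,Y]-\varphi[X,\varphi Y]$. A Sasakian structure on a Lie algebra consists of the same data given algebraically on the Lie algebra, i.e. a left-invariant Sasakian structure on a corresponding Lie group. Given a contact form $\eta$ with Reeb vector field $\xi$, a Riemannian metric $g'$ is associated to $\eta$ if there is a $(1,1)$-tensor field $\varphi'$ (necessarily unique) such that $(\varphi',\xi,\eta,g')$ is a contact metric structure. A contact metric structure $(\varphi,\xi,\eta,g)$ is a contact metric $(k,\mu)$ structure ($k,\mu\in\mathbb{R}$) if $$R(X,Y)\xi=k(\eta(Y)X-\eta(X)Y)+\mu(\eta(Y)hX-\eta(X)hY)$$ for all $X,Y$, where $h=\frac12\mathcal{L}_\xi\varphi$,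 $R(X,Y)Z=\nabla_X\nabla_YZ-\nabla_Y\nabla_XZ-\nabla_{[X,Y]}Z$ and $\nabla$ is the Levi-Civita connection of $g$. In the non-Sasakian case one has $k<1$, and the Boeckx invariant is $I=\dfrac{1-\frac{\mu}{2}}{\sqrt{1-k}}$. *)

(* Defs.v *)
From HB Require Import structures.
From mathcomp Require Import all_boot all_order all_algebra.
From mathcomp Require Import all_classical all_reals all_analysis.

Set Implicit Arguments.
Unset Strict Implicit.
Unset Printing Implicit Defensive.

Import Order.TTheory GRing.Theory Num.Theory.
Import numFieldNormedType.Exports.

Local Open Scope classical_set_scope.
Local Open Scope ring_scope.

(* Only used for [U] open and [V] finite-dimensional, where it is the usual C^k
   class.  Functions are total; their values off [U] are irrelevant. *)
Fixpoint Ck (R : realType) (V W : normedModType R) (k : nat) (U : set V)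
    (f : V -> W) : Prop :=
  match k with
  | 0%N => forall x, U x -> {for x, continuous f}
  | k'.+1 => (forall x, U x -> differentiable f x) /\
             (forall v : V, Ck k' U (fun x => 'D_v f x))
  end.

Definition smooth_on (R : realType) (V W : normedModType R) (U : set V)
    (f : V -> W) : Prop := forall k, Ck k U f.

Definition smooth_at (R : realType) (V W : normedModType R)
    (f : V -> W) (x : V) : Prop :=
  exists2 U : set V, open_nbhs x U & smooth_on U f.

(* The atlas is indexed by the points of the manifold: [chart p], with domain
   [dom p] and inverse [param p], is a chosen chart around [p].  Every smooth
   structure is generated by such an atlas (choose a chart around each point). *)
Record manifold (R : realType) (n : nat) := Manifold {
  carrier :> topologicalType;
  dom : carrier -> set carrier;
  chart : carrier -> carrier -> 'rV[R]_n;
  param : carrier -> 'rV[R]_n -> carrier;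
  manifold_hausdorff : hausdorff_space carrier;
  manifold_second_countable : @second_countable carrier;
  dom_open : forall p, open (dom p);
  dom_center : forall p, dom p p;
  chartK : forall p q, dom p q -> param p (chart p q) = q;
  chart_open : forall p, open (chart p @` dom p);
  chart_continuous : forall p q, dom p q -> {for q, continuous (chart p)};
  param_continuous : forall p x, (chart p @` dom p) x ->
    {for x, continuous (param p)};
  chart_compatible : forall p q,
    smooth_on (chart p @` (dom p `&` dom q)) (chart q \o param p) }.

Section Manifold.
Variables (R : realType) (n : nat) (M : manifold R n).
Implicit Types (p q : M) (f : M -> R).

Definition smooth_fun_at f p : Prop :=
  smooth_at (f \o param p : 'rV[R]_n -> R) (chart p p).

Definition smooth_fun f : Prop := forall p, smooth_fun_at f p.

(* The tangent space at [p] is identified with ['rV_n] through the chart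
   [chart p].  Hence tensor fields are families of row vectors (vector fields),
   column vectors (1-forms), and square matrices ((1,1)-tensors, acting on row
   vectors from the right, and (0,2)-tensors); smoothness is stated apart. *)
Definition vector_field := M -> 'rV[R]_n.
Definition one_form := M -> 'cV[R]_n.
Definition endo_field := M -> 'M[R]_n.
Definition form_field := M -> 'M[R]_n.
Implicit Types (X Y Z : vector_field).

Definition ev_one_form (eta : one_form) p (v : 'rV[R]_n) : R :=
  (v *m eta p) 0 0.
Definition ev_form (g : form_field) p (u v : 'rV[R]_n) : R :=
  (u *m g p *m v^T) 0 0.

Definition one_form_on (eta : one_form) X : M -> R :=
  fun p => ev_one_form eta p (X p).
Definition form_on (g : form_field) X Y : M -> R :=
  fun p => ev_form g p (X p) (Y p).
Definition endo_on (phi : endo_field) X : vector_field :=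
  fun p => X p *m phi p.
Definition scale_vf f X : vector_field := fun p => f p *: X p.

Definition vact X f : M -> R :=
  fun p => 'D_(X p) (f \o param p : 'rV[R]_n -> R) (chart p p).

(* [smooth_fun_at f p] is smoothness of [f] on a neighbourhood of [p]. *)
Definition smooth_vf X : Prop :=
  forall f p, smooth_fun_at f p -> smooth_fun_at (vact X f) p.

Definition smooth_one_form (eta : one_form) : Prop :=
  forall X, smooth_vf X -> smooth_fun (one_form_on eta X).
Definition smooth_endo (phi : endo_field) : Prop :=
  forall X, smooth_vf X -> smooth_vf (endo_on phi X).
Definition smooth_form (g : form_field) : Prop :=
  forall X Y, smooth_vf X -> smooth_vf Y -> smooth_fun (form_on g X Y).

(* The commutator [X (Y f) - Y (X f)], read on the coordinate functions of the
   chart at [p]. *)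
Definition lie_bracket X Y : vector_field := fun p =>
  \row_i (vact X (vact Y (fun q => chart p q 0 i)) p
          - vact Y (vact X (fun q => chart p q 0 i)) p).

Definition is_riemannian_metric (g : form_field) : Prop :=
  [/\ smooth_form g,
      forall p u v, ev_form g p u v = ev_form g p v u
    & forall p u, u != 0 -> 0 < ev_form g p u u].

Definition d_one_form (eta : one_form) X Y : M -> R := fun p =>
  2^-1 * (vact X (one_form_on eta Y) p - vact Y (one_form_on eta X) p
          - one_form_on eta (lie_bracket X Y) p).

Definition is_contact_metric (phi : endo_field) (xi : vector_field)
    (eta : one_form) (g : form_field) : Prop :=
  [/\ [/\ smooth_endo phi, smooth_vf xi, smooth_one_form eta
        & is_riemannian_metric g],
      forall p, ev_one_form eta p (xi p) = 1,
      forall p v, v *m phi p *m phi p = - v + ev_one_form eta p v *: xi p,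
      forall p u v, ev_form g p (u *m phi p) (v *m phi p)
        = ev_form g p u v - ev_one_form eta p u * ev_one_form eta p v
    & forall X Y, smooth_vf X -> smooth_vf Y -> forall p,
        form_on g X (endo_on phi Y) p = d_one_form eta X Y p].

Definition nijenhuis (phi : endo_field) X Y : vector_field :=
  let F := endo_on phi in
  F (F (lie_bracket X Y)) + lie_bracket (F X) (F Y)
  - F (lie_bracket (F X) Y) - F (lie_bracket X (F Y)).

Definition is_sasakian (phi : endo_field) (xi : vector_field)
    (eta : one_form) (g : form_field) : Prop :=
  is_contact_metric phi xi eta g /\
  forall X Y, smooth_vf X -> smooth_vf Y -> forall p,
    nijenhuis phi X Y p = (- 2 * d_one_form eta X Y p) *: xi p.

Definition associated_metric (xi : vector_field) (eta : one_form)
    (g : form_field) : Prop :=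
  exists phi : endo_field, is_contact_metric phi xi eta g.

(* [nabla X Y] is the covariant derivative of [Y] along [X]. *)
Definition is_levi_civita (g : form_field)
    (nabla : vector_field -> vector_field -> vector_field) : Prop :=
  forall X Y Z, smooth_vf X -> smooth_vf Y -> smooth_vf Z ->
  [/\ smooth_vf (nabla X Y),
      nabla (X + Y) Z = nabla X Z + nabla Y Z
        /\ nabla X (Y + Z) = nabla X Y + nabla X Z,
      forall f, smooth_fun f ->
        nabla (scale_vf f X) Y = scale_vf f (nabla X Y)
        /\ nabla X (scale_vf f Y)
           = scale_vf (vact X f) Y + scale_vf f (nabla X Y),
      nabla X Y - nabla Y X = lie_bracket X Y
    & vact X (form_on g Y Z)
      = form_on g (nabla X Y) Z + form_on g Y (nabla X Z)].

Definition curvature (nabla : vector_field -> vector_field -> vector_field)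
    X Y Z : vector_field :=
  nabla X (nabla Y Z) - nabla Y (nabla X Z) - nabla (lie_bracket X Y) Z.

(* Half the Lie derivative of [phi] along [xi]. *)
Definition h_tensor (phi : endo_field) (xi : vector_field) X : vector_field :=
  fun p => 2^-1 *: (lie_bracket xi (endo_on phi X) p
                    - endo_on phi (lie_bracket xi X) p).

Definition is_contact_metric_kmu (phi : endo_field) (xi : vector_field)
    (eta : one_form) (g : form_field) (k mu : R) : Prop :=
  is_contact_metric phi xi eta g /\
  exists2 nabla, is_levi_civita g nabla &
  forall X Y, smooth_vf X -> smooth_vf Y -> forall p,
    let h := h_tensor phi xi in
    curvature nabla X Y xi p
    = k *: (one_form_on eta Y p *: X p - one_form_on eta X p *: Y p)
      + mu *: (one_form_on eta Y p *: h X p - one_form_on eta X p *: h Y p).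

(* The structure is a non-Sasakian (k,mu) structure with Boeckx invariant [I]. *)
Definition has_boeckx_invariant (phi : endo_field) (xi : vector_field)
    (eta : one_form) (g : form_field) (I : R) : Prop :=
  ~ is_sasakian phi xi eta g /\
  exists k mu : R, [/\ is_contact_metric_kmu phi xi eta g k mu, k < 1
    & I = (1 - mu / 2) / Num.sqrt (1 - k)].

End Manifold.

Record lie_group (R : realType) (n : nat) := LieGroup {
  lie_manifold :> manifold R n;
  gmul : lie_manifold -> lie_manifold -> lie_manifold;
  ginv : lie_manifold -> lie_manifold;
  gone : lie_manifold;
  gmulA : associative gmul;
  gmul1 : left_id gone gmul;
  gmulV : left_inverse gone ginv gmul;
  gmul_continuous :
    continuous (fun z : lie_manifold * lie_manifold => gmul z.1 z.2);
  ginv_continuous : continuous ginv;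
  gmul_smooth : forall p q : lie_manifold,
    smooth_at (fun z : 'rV[R]_n * 'rV[R]_n =>
                 chart (gmul p q) (gmul (param p z.1) (param q z.2)))
              (chart p p, chart q q);
  ginv_smooth : forall p : lie_manifold,
    smooth_at (fun x : 'rV[R]_n => chart (ginv p) (ginv (param p x)))
              (chart p p) }.

Arguments gone {R n} l.

Section LieGroup.
Variables (R : realType) (n : nat) (G : lie_group R n).
Implicit Types (p q : G).

(* Differential at [q] of the left translation by [p]. *)
Definition dleft p q (v : 'rV[R]_n) : 'rV[R]_n :=
  'D_v (fun x : 'rV[R]_n => chart (gmul p q) (gmul p (param q x)))
       (chart q q).

Definition left_invariant_vf (X : vector_field G) : Prop :=
  forall p q, X (gmul p q) = dleft p q (X q).
Definition left_invariant_one_form (eta : one_form G) : Prop :=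
  forall p q v, ev_one_form eta (gmul p q) (dleft p q v) = ev_one_form eta q v.
Definition left_invariant_endo (phi : endo_field G) : Prop :=
  forall p q v, dleft p q v *m phi (gmul p q) = dleft p q (v *m phi q).
Definition left_invariant_form (g : form_field G) : Prop :=
  forall p q u v,
    ev_form g (gmul p q) (dleft p q u) (dleft p q v) = ev_form g q u v.

(* [lam] is an isomorphism from the Lie algebra (['rV_n], [br]) onto the Lie
   algebra of left-invariant vector fields of [G]. *)
Definition is_lie_algebra_iso (br : 'rV[R]_n -> 'rV[R]_n -> 'rV[R]_n)
    (lam : 'rV[R]_n -> vector_field G) : Prop :=
  [/\ forall (a : R) x y p, lam (a *: x + y) p = a *: lam x p + lam y p,
      injective lam,
      forall x, smooth_vf (lam x) /\ left_invariant_vf (lam x),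
      forall X, smooth_vf X -> left_invariant_vf X -> exists x, lam x = X
    & forall x y, lam (br x y) = lie_bracket (lam x) (lam y)].

(* The left-invariant tensors (phi, xi, eta, g) on [G] induced by algebraic data
   (phi0, xi0, eta0, g0) on the Lie algebra; T_eG is identified with the Lie
   algebra by [x |-> lam x (gone G)]. *)
Definition is_left_invariant_structure (lam : 'rV[R]_n -> vector_field G)
    (phi0 : 'rV[R]_n -> 'rV[R]_n) (xi0 : 'rV[R]_n)
    (eta0 : 'rV[R]_n -> R) (g0 : 'rV[R]_n -> 'rV[R]_n -> R)
    (phi : endo_field G) (xi : vector_field G)
    (eta : one_form G) (g : form_field G) : Prop :=
  let at1 x := lam x (gone G) in
  [/\ [/\ left_invariant_endo phi, left_invariant_vf xi,
          left_invariant_one_form eta & left_invariant_form g],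
      forall x, at1 x *m phi (gone G) = at1 (phi0 x),
      xi (gone G) = at1 xi0,
      forall x, ev_one_form eta (gone G) (at1 x) = eta0 x
    & forall x y, ev_form g (gone G) (at1 x) (at1 y) = g0 x y].

End LieGroup.

Section Algebra.
Variable R : realType.
Implicit Types (x y : 'rV[R]_5).

(* The basis e_1, ..., e_5: coordinates are numbered from 1 here. *)
Definition basis5 (k : nat) : 'rV[R]_5 := delta_mx 0 (inord k.-1).

Definition structure_constants (i j : nat) : 'rV[R]_5 :=
  let s := Num.sqrt 2 : R in
  match i, j with
  | 1%N, 2%N => s *: basis5 2 - 2 *: basis5 5
  | 2%N, 3%N => s *: basis5 4
  | 2%N, 4%N => - (s *: basis5 3)
  | 3%N, 4%N => - (2 *: basis5 5)
  | 3%N, 5%N => - basis5 4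
  | 4%N, 5%N => basis5 3
  | _, _ => 0
  end.

Definition coord5 x (k : nat) : R := x 0 (inord k.-1).

Definition bracket5 x y : 'rV[R]_5 :=
  \sum_(1 <= i < 6) \sum_(1 <= j < 6) (coord5 x i * coord5 y j) *:
    (structure_constants i j - structure_constants j i).

Definition phi5 x : 'rV[R]_5 :=
  coord5 x 1 *: - basis5 2 + coord5 x 2 *: basis5 1
  + coord5 x 3 *: - basis5 4 + coord5 x 4 *: basis5 3.
Definition xi5 : 'rV[R]_5 := basis5 5.
Definition eta5 x : R := coord5 x 5.
Definition metric5 x y : R := \sum_(1 <= k < 6) coord5 x k * coord5 y k.

Definition is_orthogonal_decomposition (Dp Dm : {vspace 'rV[R]_5}) : Prop :=
  [/\ (Dp + Dm + <[xi5]>)%VS = fullv, directv (Dp + Dm + <[xi5]>),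
      forall x y, x \in Dp -> y \in Dm -> metric5 x y = 0,
      forall x, x \in Dp -> metric5 x xi5 = 0
    & forall x, x \in Dm -> metric5 x xi5 = 0].

Definition summand (Dp Dm : {vspace 'rV[R]_5}) (i : 'I_3) : {vspace 'rV[R]_5} :=
  nth 0%VS [:: Dp; Dm; <[xi5]>%VS] i.

Definition is_deformed_metric (G : lie_group R 5)
    (lam : 'rV[R]_5 -> vector_field G) (eta : one_form G) (g : form_field G)
    (Dp Dm : {vspace 'rV[R]_5}) (a : R) (ga : form_field G) : Prop :=
  let at1 x := lam x (gone G) in
  [/\ left_invariant_form ga,
      forall x y, x \in Dp -> y \in Dp ->
        ev_form ga (gone G) (at1 x) (at1 y)
        = a^-1 * ev_form g (gone G) (at1 x) (at1 y),
      forall x y, x \in Dm -> y \in Dm ->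
        ev_form ga (gone G) (at1 x) (at1 y)
        = a * ev_form g (gone G) (at1 x) (at1 y)
    & forall i j : 'I_3, ~~ ((i == j) && (i < 2)%N) -> forall x y,
        x \in summand Dp Dm i -> y \in summand Dp Dm j ->
        ev_form ga (gone G) (at1 x) (at1 y)
        = ev_one_form eta (gone G) (at1 x) * ev_one_form eta (gone G) (at1 y)].

End Algebra.

(* Main.v *)
Require Import Defs.
From HB Require Import structures.
From mathcomp Require Import all_boot all_order all_algebra.
From mathcomp Require Import all_classical all_reals all_analysis.
From mathcomp Require Import ring lra.

Set Implicit Arguments.
Unset Strict Implicit.
Unset Printing Implicit Defensive.

Import Order.TTheory GRing.Theory Num.Theory.
Import numFieldNormedType.Exports.

Local Open Scope classical_set_scope.
Local Open Scope ring_scope.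

(* The left-invariant vector fields form a global smooth frame, in which every
   vector field is a row of smooth coefficient functions and every
   left-invariant tensor is a constant matrix.  In this frame the Leibniz rule
   reduces statements on the Nijenhuis tensor, h, the Levi-Civita connection and
   the curvature to polynomial identities in the structure constants.

   Take d_+ = span(e_1 + e_3, e_2 - e_4) and d_- = span(e_1 - e_3, e_2 + e_4).
   With c = (a + 1/a) / 2 and d = (a - 1/a) / 2, so that c^2 - d^2 = 1, the
   entries of g_a, phi_a and the Christoffel symbols are polynomials in c and d,
   and one finds k = 1 - (d / 2)^2 and mu = 2 + c, hence I_a = - c / d. *)

(** * Smooth functions on normed modules *)

(** Components of a vector field at [p] are read in the chart of [p], and [vact] at a neighbouring
    point uses another chart, so components at different points cannot be differentiated together.
    Coefficients in the invariant frame are genuine real functions, and the action on functions does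
    not depend on the chart; hence the detour through [fcoef]. The constants are c = cosh t and d =
    sinh t for a = exp t, so the scale factors on d_+ and d_- are c - d = 1/a and c + d = a, and
    every identity is polynomial over the rationals and sqrt 2, modulo c^2 = 1 + d^2. The values of
    k and mu can be read off from R(e_1, xi) xi alone. *)

Section SmoothFunctions.
Variables (R : realType) (V : normedModType R).
Implicit Types (f g : V -> R) (x v : V) (U : set V).

(** The first-order expansion of [f] at [x] is also one of [g], since the two agree near [x];
    uniqueness of the differential then identifies ['d g x] with ['d f x]. *)
Lemma near_eq_differentiable f g x :
  (\near x, f x = g x) -> differentiable f x -> differentiable g x.
Proof.
move=> fg df; have /diff_locallyP[dfc dfE] := df.
have dgE : g \o shift x = cst (g x) + 'd f x +o_ 0 id.
  apply/eqaddoP => _/posnumP[e].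
  have e0 : 0 < e%:num by [].
  have {}dfE := (eqaddoP _ _ _ _).1 dfE _ e0.
  have {}fg0 : \forall h \near 0, f (h + x) = g (h + x).
    have := fg; rewrite (near_shift 0 x) /=.
    by apply: filterS => h /=; rewrite subr0.
  apply: filterS2 dfE fg0 => h /=; rewrite !fctE /= => le_e fgh.
  by rewrite -(nbhs_singleton fg) -fgh.
apply/diff_locallyP; rewrite (diff_unique dfc dgE).
by split; [exact: dfc|exact: dgE].
Qed.

Lemma Ck_sub k U U' f : U' `<=` U -> Ck k U f -> Ck k U' f.
Proof.
move=> U'U; elim: k f => [|k IHk] f /=; first by move=> + x /U'U; apply.
by move=> [df Df]; split=> [x /U'U /df//|v]; exact: IHk.
Qed.

(** Openness turns equality on [U] into equality near each point of [U], so that the derivatives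
    agree on [U] too and the induction goes through. *)
Lemma eq_Ck k U f g : open U -> (forall x, U x -> f x = g x) ->
  Ck k U f -> Ck k U g.
Proof.
move=> oU; have nearU h h' : (forall x, U x -> h x = h' x) ->
    forall x, U x -> \near x, h x = h' x :> R.
  by move=> hh' x Ux; apply: filterS hh' _; exact: open_nbhs_nbhs.
elim: k f g => [|k IHk] f g fg /=.
  move=> cf x Ux; have := cf x Ux.
  rewrite /prop_for /continuous_at -(fg x Ux) => cfx.
  by apply: cvg_trans cfx; apply: near_eq_cvg; exact: nearU.
move=> [df Df]; split=> [x Ux|v].
  exact: near_eq_differentiable (nearU _ _ fg _ Ux) (df x Ux).
by apply: IHk (Df v) => x Ux; apply: near_eq_derive; exact: nearU.
Qed.

Lemma CkW k U f : Ck k.+1 U f -> Ck k U f.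
Proof.
elim: k f => [|k IHk] f /= [df Df].
  by move=> x /df /differentiable_continuous.
by split=> // v; exact: IHk.
Qed.

Lemma Ck_cst k U (r : R) : Ck k U (cst r : V -> R).
Proof.
elim: k r => [|k IHk] r /=; first by move=> x _; exact: cvg_cst.
split=> [x _|v]; first exact: differentiable_cst.
by rewrite (_ : (fun x => _) = cst 0)//; apply/funext => x; exact: derive_cst.
Qed.

Lemma CkD k U f g : open U -> Ck k U f -> Ck k U g -> Ck k U (f + g).
Proof.
move=> oU; elim: k f g => [|k IHk] f g /=.
  by move=> cf cg x Ux; apply: cvgD; [exact: cf|exact: cg].
move=> [df Df] [dg Dg]; split=> [x Ux|v].
  by apply: differentiableD; [exact: df|exact: dg].
apply: eq_Ck oU _ (IHk _ _ (Df v) (Dg v)) => x Ux.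
by rewrite deriveD//; apply: diff_derivable; [exact: df|exact: dg].
Qed.

Lemma CkM k U f g : open U -> Ck k U f -> Ck k U g -> Ck k U (f * g).
Proof.
move=> oU; elim: k f g => [|k IHk] f g /=.
  by move=> cf cg x Ux; apply: cvgM; [exact: cf|exact: cg].
move=> Sf Sg; have [df Df] := Sf; have [dg Dg] := Sg; split=> [x Ux|v].
  by apply: differentiableM; [exact: df|exact: dg].
have fDg := IHk _ _ (CkW Sf) (Dg v); have gDf := IHk _ _ (CkW Sg) (Df v).
apply: eq_Ck oU _ (CkD oU fDg gDf) => x Ux.
by rewrite deriveM//; apply: diff_derivable; [exact: df|exact: dg].
Qed.

(** The derivative of 1/f is - (1/f)^2 times that of f, which involves 1/f one order lower:
    induction on [k] with [f] fixed. *)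
Lemma CkV k U f : open U -> (forall x, U x -> f x != 0) ->
  Ck k U f -> Ck k U (fun x => (f x)^-1).
Proof.
move=> oU f0; elim: k => [|k IHk] Sf.
  by move=> x Ux; apply: cvgV; [exact: f0|exact: Sf].
have [df Df] := Sf; have Vf := IHk (CkW Sf); split=> [x Ux|v].
  by apply: differentiableV; [exact: df|exact: f0].
apply: eq_Ck oU _ (CkM oU (Ck_cst k U (-1)) (CkM oU (CkM oU Vf Vf) (Df v))).
move=> x Ux; rewrite deriveV ?f0 //; last by apply: diff_derivable; exact: df.
by rewrite !fctE /cst /GRing.scale /= -exprVn; ring.
Qed.

Lemma near_smooth_at f g x : (\near x, f x = g x) ->
  smooth_at f x -> smooth_at g x.
Proof.
move=> fg [U [oU Ux] Sf].
exists (U `&` (fun y => f y = g y)^°).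
  split; last by split.
  by apply: openI => //; exact: open_interior.
move=> k; apply: (@eq_Ck _ _ f).
- by apply: openI => //; exact: open_interior.
- by move=> y [_ /interior_subset].
- by apply: Ck_sub (Sf k) => y [].
Qed.

Lemma smooth_at_cst (r : R) x : smooth_at (cst r : V -> R) x.
Proof.
by exists setT; [split=> //; exact: openT|move=> k; exact: Ck_cst].
Qed.

Lemma smooth_atD f g x : smooth_at f x -> smooth_at g x -> smooth_at (f + g) x.
Proof.
move=> [U [oU Ux] Sf] [U' [oU' U'x] Sg].
exists (U `&` U'); first by split; [exact: openI|].
by move=> k; apply: CkD; [exact: openI| |];
  [apply: Ck_sub (Sf k)|apply: Ck_sub (Sg k)] => y [].
Qed.

Lemma smooth_atM f g x : smooth_at f x -> smooth_at g x -> smooth_at (f * g) x.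
Proof.
move=> [U [oU Ux] Sf] [U' [oU' U'x] Sg].
exists (U `&` U'); first by split; [exact: openI|].
by move=> k; apply: CkM; [exact: openI| |];
  [apply: Ck_sub (Sf k)|apply: Ck_sub (Sg k)] => y [].
Qed.

Lemma smooth_at_differentiable f x : smooth_at f x ->
  \near x, differentiable f x.
Proof.
move=> [U oU /(_ 1%N)[df _]]; apply: filterS df _; exact: open_nbhs_nbhs.
Qed.

Lemma smooth_atV f x : f x != 0 -> smooth_at f x ->
  smooth_at (fun y => (f y)^-1) x.
Proof.
move=> fx0 Sf; have [U [oU Ux] SUf] := Sf.
have cf : {for x, continuous f} by exact: SUf 0%N x Ux.
have f0 : \near x, f x != 0.
  have : \forall r \near f x, r != 0 by exact: open_nbhs_nbhs.
  exact: cf.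
exists (U `&` (fun y => f y != 0)^°).
  by split; [apply: openI => //; exact: open_interior|split].
move=> k; apply: CkV.
- by apply: openI => //; exact: open_interior.
- by move=> y [_ /interior_subset].
- by apply: Ck_sub (SUf k) => y [].
Qed.

Lemma smooth_at_derive f x v : smooth_at f x -> smooth_at ('D_v f) x.
Proof.
by move=> [U oU Sf]; exists U => // k; have [_ /(_ v)] := Sf k.+1.
Qed.

End SmoothFunctions.

Lemma derive_coord (R : realType) m n (x v : 'M[R]_(m, n)) i j :
  'D_v (fun y : 'M[R]_(m, n) => y i j : R) x = v i j.
Proof.
have := @derive_mx R 'M[R]_(m, n) m n id x v (@derivable_id _ _ x v).
by rewrite derive_id => /matrixP/(_ i j); rewrite mxE => <-.
Qed.

Lemma smooth_at_coord (R : realType) m n (x : 'M[R]_(m, n)) i j :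
  smooth_at (fun y : 'M[R]_(m, n) => y i j : R) x.
Proof.
exists setT; first by split=> //; exact: openT.
case=> [|k] /=.
  by move=> y _; apply: differentiable_continuous; exact: differentiable_coord.
split=> [y _|v]; first exact: differentiable_coord.
rewrite (_ : (fun y => _) = cst (v i j)); first exact: Ck_cst.
by apply/funext => y; exact: derive_coord.
Qed.

(** * Derivations of functions on a manifold *)

Section ManifoldCalculus.
Variables (R : realType) (n : nat) (M : manifold R n).
Implicit Types (p q : M) (f g h : M -> R) (X Y Z : vector_field M).

Local Notation coord p i := (fun q => chart p q 0 i : R).

(** Neighbourhoods are transported at any point [q] of [dom p], not only at the centre, because a
    fixed chart is followed at varying points. *)
Lemma near_param p q (P : set M) :
  dom p q -> nbhs q P -> \forall x \near chart p q, P (param p x).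
Proof.
move=> pq nP; have := @param_continuous _ _ M p (chart p q).
rewrite /prop_for /continuous_at chartK // => /(_ _)/(_ P); apply => //.
Qed.

Lemma near_chart p q (P : set 'rV[R]_n) :
  dom p q -> nbhs (chart p q) P -> \forall q' \near q, P (chart p q').
Proof. by move=> pq; apply: (chart_continuous pq). Qed.

Lemma near_dom p q : dom p q -> \forall q' \near q, dom p q'.
Proof.
by move=> pq; apply: open_nbhs_nbhs; split=> //; exact: dom_open.
Qed.

Lemma near_paramK p q :
  dom p q -> \forall x \near chart p q, chart p (param p x) = x.
Proof.
move=> pq; have : nbhs (chart p q) (chart p @` dom p).
  by apply: open_nbhs_nbhs; split; [exact: chart_open|exists q].
by apply: filterS => x [q' pq' <-]; rewrite chartK.
Qed.

Lemma near_smooth_fun_at f g p : (\near p, f p = g p) ->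
  smooth_fun_at f p -> smooth_fun_at g p.
Proof.
move=> fg; apply: near_smooth_at.
exact: (near_param (dom_center p) fg).
Qed.

Lemma smooth_fun_at_cst (r : R) p : smooth_fun_at (cst r) p.
Proof. exact: smooth_at_cst. Qed.

Lemma smooth_fun_atD f g p :
  smooth_fun_at f p -> smooth_fun_at g p -> smooth_fun_at (f + g) p.
Proof. exact: smooth_atD. Qed.

Lemma smooth_fun_atM f g p :
  smooth_fun_at f p -> smooth_fun_at g p -> smooth_fun_at (f * g) p.
Proof. exact: smooth_atM. Qed.

Lemma smooth_fun_atV f p : f p != 0 ->
  smooth_fun_at f p -> smooth_fun_at (fun q => (f q)^-1) p.
Proof.
move=> fp0; apply: smooth_atV; rewrite /= chartK //; exact: dom_center.
Qed.

Lemma smooth_fun_at_sum (I : Type) (s : seq I) (P : pred I)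
    (F : I -> M -> R) p : (forall i, smooth_fun_at (F i) p) ->
  smooth_fun_at (fun q => \sum_(i <- s | P i) F i q) p.
Proof.
move=> SF; elim: s => [|i s IHs].
  by under eq_fun do rewrite big_nil; exact: smooth_fun_at_cst.
under eq_fun do rewrite big_cons.
by case: (P i) => //; exact: smooth_fun_atD.
Qed.

Lemma smooth_fun_at_prod (I : Type) (s : seq I) (P : pred I)
    (F : I -> M -> R) p : (forall i, smooth_fun_at (F i) p) ->
  smooth_fun_at (fun q => \prod_(i <- s | P i) F i q) p.
Proof.
move=> SF; elim: s => [|i s IHs].
  by under eq_fun do rewrite big_nil; exact: smooth_fun_at_cst.
under eq_fun do rewrite big_cons.
by case: (P i) => //; exact: smooth_fun_atM.
Qed.

Lemma smooth_fun_at_det m (A : M -> 'M[R]_m) p :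
  (forall i j, smooth_fun_at (fun q => A q i j) p) ->
  smooth_fun_at (fun q => \det (A q)) p.
Proof.
move=> SA; apply: smooth_fun_at_sum => s.
apply: smooth_fun_atM; first exact: smooth_fun_at_cst.
exact: smooth_fun_at_prod.
Qed.

Lemma smooth_fun_at_invmx m (A : M -> 'M[R]_m) p : A p \in unitmx ->
  (forall i j, smooth_fun_at (fun q => A q i j) p) ->
  (\near p, A p \in unitmx) /\
  forall i j, smooth_fun_at (fun q => invmx (A q) i j) p.
Proof.
move=> Au SA; have Sdet := smooth_fun_at_det SA.
have near_unit : \near p, A p \in unitmx.
  have [U [oU Ux] SU] := Sdet.
  have cdet : {for chart p p, continuous ((fun q => \det (A q)) \o param p)}.
    exact: SU 0%N _ Ux.
  have n0 : \forall r \near \det (A (param p (chart p p))), r != 0.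
    apply: open_nbhs_nbhs; split=> //.
    by rewrite /= chartK -?unitfE -?unitmxE //; exact: dom_center.
  have := near_chart (dom_center p) (cdet _ n0).
  have := near_dom (dom_center p).
  apply: filterS2 => q pq /=.
  by rewrite chartK // unitmxE unitfE.
split=> // i j.
(* Outside [unitmx], [invmx] returns the matrix itself, so the cofactor formula holds only where
   [A q] is invertible, that is, near [p]. *)
apply: (@near_smooth_fun_at
  (fun q => (\det (A q))^-1 *
    ((-1) ^+ (j + i) * \det (row' j (col' i (A q)))))).
  apply: filterS near_unit => q Aq.
  by rewrite /invmx Aq !mxE.
apply: smooth_fun_atM.
  by apply: smooth_fun_atV => //; rewrite -unitfE -unitmxE.
apply: smooth_fun_atM; first exact: smooth_fun_at_cst.
by apply: smooth_fun_at_det => k l; under eq_fun do rewrite !mxE; exact: SA.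
Qed.

Definition differentiable_fun_at f p :=
  differentiable (f \o param p) (chart p p).

Lemma transition_differentiable p q : dom p q ->
  differentiable (chart p \o param q) (chart q q).
Proof.
move=> pq; have [dpq _] := @chart_compatible _ _ M q p 1%N.
by apply: dpq; exists q => //; split => //; exact: dom_center.
Qed.

(* [f] is read in the chart of [p], although [vact] and
   [differentiable_fun_at] at [q] use the chart of [q]. *)
Lemma vact_chart X f p q : dom p q ->
  differentiable (f \o param p) (chart p q) ->
  differentiable_fun_at f q /\
  vact X f q = 'd (f \o param p) (chart p q)
                 ('D_(X q) (chart p \o param q) (chart q q)).
Proof.
move=> pq df; have dpq := transition_differentiable pq.
have pqq : (chart p \o param q) (chart q q) = chart p q.
  by rewrite /= chartK //; exact: dom_center.
rewrite -pqq in df *.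
have dcomp := differentiable_comp dpq df.
have fE : \forall x \near chart q q,
    ((f \o param p) \o (chart p \o param q)) x = (f \o param q) x.
  have := near_param (dom_center q) (near_dom pq).
  by apply: filterS => x px /=; rewrite chartK.
split; first exact: near_eq_differentiable fE dcomp.
rewrite /vact -(near_eq_derive (X q) fE) (deriveE (X q) dcomp).
rewrite (deriveE (X q) dpq).
exact: (congr1 (fun l : 'rV_n -> R => l (X q)) (diff_comp dpq df)).
Qed.

(** Smoothness at [p] gives differentiability at nearby points in the chart of [p]; [vact_chart],
    instantiated with the zero field, moves it to their own charts. *)
Lemma smooth_fun_at_differentiable f p : smooth_fun_at f p ->
  \near p, differentiable_fun_at f p.
Proof.
move=> /smooth_at_differentiable /(near_chart (dom_center p)).
have := near_dom (dom_center p).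
by apply: filterS2 => q pq /(vact_chart 0 pq)[].
Qed.

Lemma vact_coord X p q i : dom p q ->
  vact X (coord p i) q = 'D_(X q) (chart p \o param q) (chart q q) 0 i.
Proof.
move=> pq; have dpq := transition_differentiable pq.
by rewrite derive_mx ?mxE //; exact: diff_derivable.
Qed.

Lemma vact_coordE X p i : vact X (coord p i) p = X p 0 i.
Proof.
rewrite vact_coord; last exact: dom_center.
rewrite (@near_eq_derive _ _ _ _ id) ?derive_id //.
exact: near_paramK (dom_center p).
Qed.

Lemma smooth_fun_at_coord p i : smooth_fun_at (coord p i) p.
Proof.
apply: near_smooth_at (smooth_at_coord (chart p p) 0 i).
by apply: filterS (near_paramK (dom_center p)) => x /= ->.
Qed.

(** By the chain rule, X f is near [p] the sum of X(x_i) times the i-th partial derivative of f in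
    the chart of [p], so the coordinate functions test smoothness. *)
Lemma smooth_vfP X :
  smooth_vf X <-> forall p i, smooth_fun_at (vact X (coord p i)) p.
Proof.
split=> [SX p i|SX f p Sf]; first exact/SX/smooth_fun_at_coord.
pose F i q := vact X (coord p i) q *
  'D_(delta_mx 0 i) (f \o param p : 'rV[R]_n -> R) (chart p q).
apply: (@near_smooth_fun_at (fun q => \sum_i F i q)).
  have := near_chart (dom_center p) (smooth_at_differentiable Sf).
  have := near_dom (dom_center p).
  apply: filterS2 => q pq df; have [_ ->] := vact_chart X pq df.
  rewrite [in RHS](row_sum_delta ('D_(X q) _ _)) linear_sum /=.
  by apply: eq_bigr => i _; rewrite linearZ /F vact_coord // (deriveE _ df).
apply: smooth_fun_at_sum => i; apply: smooth_fun_atM => //.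
apply: near_smooth_at (smooth_at_derive (delta_mx 0 i) Sf).
by apply: filterS (near_paramK (dom_center p)) => x /= ->.
Qed.

Lemma near_vact X f g p : (\near p, f p = g p) -> vact X f p = vact X g p.
Proof.
move=> fg; apply: near_eq_derive.
exact: (near_param (dom_center p) fg).
Qed.

Lemma vact_cst X (r : R) p : vact X (cst r) p = 0.
Proof. exact: derive_cst. Qed.

Lemma vactD X f g p : smooth_fun_at f p -> smooth_fun_at g p ->
  vact X (f + g) p = vact X f p + vact X g p.
Proof.
move=> /smooth_fun_at_differentiable/nbhs_singleton df.
move=> /smooth_fun_at_differentiable/nbhs_singleton dg.
by rewrite /vact -deriveD //; exact: diff_derivable.
Qed.

Lemma vactM X f g p : smooth_fun_at f p -> smooth_fun_at g p ->
  vact X (f * g) p = f p * vact X g p + vact X f p * g p.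
Proof.
move=> /smooth_fun_at_differentiable/nbhs_singleton df.
move=> /smooth_fun_at_differentiable/nbhs_singleton dg.
have := @deriveM _ _ _ _ (chart p p) (X p)
  (diff_derivable df) (diff_derivable dg).
rewrite -/(vact X f p) -/(vact X g p) -/(vact X (f * g) p).
rewrite /GRing.scale /= chartK => [->|]; last exact: dom_center.
by rewrite [X in _ + X]mulrC.
Qed.

Lemma vact_sum (I : Type) (s : seq I) X (F : I -> M -> R) p :
  (forall i, smooth_fun_at (F i) p) ->
  vact X (fun q => \sum_(i <- s) F i q) p = \sum_(i <- s) vact X (F i) p.
Proof.
move=> SF; elim: s => [|i s IHs].
  by under eq_fun do rewrite big_nil; rewrite big_nil vact_cst.
under eq_fun do rewrite big_cons.
rewrite big_cons -IHs; apply: vactD => //; exact: smooth_fun_at_sum.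
Qed.

Lemma vact_linear (X : vector_field M) f p (I : finType) (a : I -> R)
    (E : I -> vector_field M) :
  differentiable_fun_at f p -> X p = \sum_i a i *: E i p ->
  vact X f p = \sum_i a i * vact (E i) f p.
Proof.
move=> df XE; rewrite /vact deriveE // XE linear_sum /=.
by apply: eq_bigr => i _; rewrite linearZ /= deriveE.
Qed.

End ManifoldCalculus.

(** * Tensors with constant coefficients in a global frame *)

Section Frame.
Variables (R : realType) (n : nat) (M : manifold R n).
Implicit Types (p q : M) (f g : M -> R) (X Y Z : vector_field M).
Implicit Types (y z : M -> 'rV[R]_n).

Local Notation coord p i := (fun q => chart p q 0 i : R).

Definition smooth_row y :=
  forall p j, smooth_fun_at (fun q => y q 0 j) p.

(** On rows of frame coefficients this is the flat connection for which the frame is parallel. *)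
Definition row_act X y : M -> 'rV[R]_n :=
  fun p => \row_j vact X (fun q => y q 0 j) p.

Lemma smooth_rowD y z :
  smooth_row y -> smooth_row z -> smooth_row (fun p => y p + z p).
Proof.
move=> Sy Sz p j; under eq_fun do rewrite mxE; exact: smooth_fun_atD.
Qed.

Lemma smooth_rowZ f y :
  smooth_fun f -> smooth_row y -> smooth_row (fun p => f p *: y p).
Proof.
move=> Sf Sy p j; under eq_fun do rewrite mxE.
by apply: smooth_fun_atM; [exact: Sf|exact: Sy].
Qed.

Lemma smooth_row_mul (T : 'M[R]_n) y :
  smooth_row y -> smooth_row (fun p => y p *m T).
Proof.
move=> Sy p j; under eq_fun do rewrite mxE.
apply: smooth_fun_at_sum => i; apply: smooth_fun_atM => //.
exact: smooth_fun_at_cst.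
Qed.

Lemma smooth_row_sum (I : Type) (s : seq I) (F : I -> M -> 'rV[R]_n) :
  (forall i, smooth_row (F i)) -> smooth_row (fun p => \sum_(i <- s) F i p).
Proof.
move=> SF p j; under eq_fun do rewrite summxE.
by apply: smooth_fun_at_sum => i; exact: SF.
Qed.

Lemma row_actD X y z p : smooth_row y -> smooth_row z ->
  row_act X (fun q => y q + z q) p = row_act X y p + row_act X z p.
Proof.
move=> Sy Sz; apply/rowP => j; rewrite !mxE; under eq_fun do rewrite mxE.
by rewrite -vactD.
Qed.

Lemma row_act_cst X (x : 'rV[R]_n) p : row_act X (cst x) p = 0.
Proof. by apply/rowP => j; rewrite !mxE vact_cst. Qed.

Lemma row_actZ X f y p : smooth_fun f -> smooth_row y ->
  row_act X (fun q => f q *: y q) p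
  = vact X f p *: y p + f p *: row_act X y p.
Proof.
move=> Sf Sy; apply/rowP => j; rewrite !mxE; under eq_fun do rewrite mxE.
by rewrite addrC; exact: (vactM X (Sf p) (Sy p j)).
Qed.

Lemma row_act_mul (T : 'M[R]_n) X y p : smooth_row y ->
  row_act X (fun q => y q *m T) p = row_act X y p *m T.
Proof.
move=> Sy; apply/rowP => j; rewrite !mxE; under eq_fun do rewrite mxE.
rewrite vact_sum => [|i]; last first.
  by apply: smooth_fun_atM => //; exact: smooth_fun_at_cst.
apply: eq_bigr => i _; rewrite mxE.
have := vactM X (Sy p i) (smooth_fun_at_cst (T i j) p).
by rewrite vact_cst mulr0 add0r => <-.
Qed.

Lemma vact_mul_col (e : 'cV[R]_n) X y p : smooth_row y ->
  smooth_fun_at (fun q => (y q *m e) 0 0) p /\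
  vact X (fun q => (y q *m e) 0 0) p = (row_act X y p *m e) 0 0.
Proof.
move=> Sy.
have S i : smooth_fun_at (fun q => y q 0 i * e i 0) p.
  by apply: smooth_fun_atM => //; exact: smooth_fun_at_cst.
under eq_fun do rewrite mxE; split; first exact: smooth_fun_at_sum.
rewrite vact_sum // mxE; apply: eq_bigr => i _; rewrite mxE.
have := vactM X (Sy p i) (smooth_fun_at_cst (e i 0) p).
by rewrite vact_cst mulr0 add0r => <-.
Qed.

Lemma vact_form (Q : 'M[R]_n) X y z p : smooth_row y -> smooth_row z ->
  smooth_fun_at (fun q => (y q *m Q *m (z q)^T) 0 0) p /\
  vact X (fun q => (y q *m Q *m (z q)^T) 0 0) p
  = (row_act X y p *m Q *m (z p)^T) 0 0
    + (y p *m Q *m (row_act X z p)^T) 0 0.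
Proof.
move=> Sy Sz; have Sw := smooth_row_mul Q Sy.
have S i : smooth_fun_at (fun q => (y q *m Q) 0 i * z q 0 i) p.
  by apply: smooth_fun_atM; [exact: Sw|exact: Sz].
have dot (u v : 'rV[R]_n) : (u *m v^T) 0 0 = \sum_i u 0 i * v 0 i.
  by rewrite mxE; apply: eq_bigr => i _; rewrite mxE.
under eq_fun do rewrite dot; split; first exact: smooth_fun_at_sum.
rewrite vact_sum // -row_act_mul // !dot -big_split; apply: eq_bigr => i _ /=.
have rowE w : row_act X w p 0 i = vact X (fun q => w q 0 i) p by rewrite mxE.
rewrite addrC !rowE.
exact: (vactM X (Sw p i) (Sz p i)).
Qed.

(** * Coefficients of vector fields and tensors in a global frame *)

Variable L : M -> 'M[R]_n.

(** [L p] turns frame coefficients into components in the chart of [p]; the tensors below are the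
    constants [e], [P], [Q] transported by this change of basis. *)
Definition frame_vf (x : 'rV[R]_n) : vector_field M := fun p => x *m L p.
Definition frame_one_form (e : 'cV[R]_n) : one_form M :=
  fun p => invmx (L p) *m e.
Definition frame_endo (P : 'M[R]_n) : endo_field M :=
  fun p => invmx (L p) *m P *m L p.
Definition frame_form (Q : 'M[R]_n) : form_field M :=
  fun p => invmx (L p) *m Q *m (invmx (L p))^T.

Definition fcoef X : M -> 'rV[R]_n := fun p => X p *m invmx (L p).

Hypothesis L_unit : forall p, L p \in unitmx.
Hypothesis L_smooth : forall x, smooth_vf (frame_vf x).

Local Notation E i := (frame_vf (delta_mx 0 i)).

Lemma fcoefK X p : fcoef X p *m L p = X p.
Proof. by rewrite /fcoef mulmxKV. Qed.

Lemma fcoef_frame y : fcoef (fun p => y p *m L p) = y.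
Proof. by apply/funext => p; rewrite /fcoef mulmxK. Qed.

Lemma fcoef_frame_vf x : fcoef (frame_vf x) = cst x.
Proof. exact: (fcoef_frame (cst x)). Qed.

Lemma fcoefD X Y : fcoef (X + Y) = fun p => fcoef X p + fcoef Y p.
Proof. by apply/funext => p; rewrite /fcoef mulmxDl. Qed.

Lemma fcoefZ f X : fcoef (scale_vf f X) = fun p => f p *: fcoef X p.
Proof. by apply/funext => p; rewrite /fcoef -scalemxAl. Qed.

Lemma fcoef_endo P X :
  fcoef (endo_on (frame_endo P) X) = fun p => fcoef X p *m P.
Proof.
by apply/funext => p; rewrite /fcoef /endo_on /frame_endo !mulmxA mulmxK.
Qed.

Lemma one_form_on_frame e X :
  one_form_on (frame_one_form e) X = fun p => (fcoef X p *m e) 0 0.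
Proof.
by apply/funext => p; rewrite /one_form_on /ev_one_form mulmxA.
Qed.

Lemma form_on_frame Q X Y :
  form_on (frame_form Q) X Y = fun p => (fcoef X p *m Q *m (fcoef Y p)^T) 0 0.
Proof.
apply/funext => p; rewrite /form_on /ev_form /frame_form /fcoef.
by rewrite trmx_mul !mulmxA.
Qed.

Lemma frame_expansion X p : X p = \sum_i fcoef X p 0 i *: E i p.
Proof.
rewrite -[LHS]fcoefK [in LHS](row_sum_delta (fcoef X p)) mulmx_suml.
by apply: eq_bigr => i _; rewrite -scalemxAl.
Qed.

Lemma vact_frame X f p : differentiable_fun_at f p ->
  vact X f p = \sum_i fcoef X p 0 i * vact (E i) f p.
Proof. by move=> df; apply: vact_linear => //; exact: frame_expansion. Qed.

Lemma near_vact_coord X p i : \forall q \near p,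
  vact X (coord p i) q = \sum_j fcoef X q 0 j * vact (E j) (coord p i) q.
Proof.
have := smooth_fun_at_differentiable (smooth_fun_at_coord p i).
by apply: filterS => q; exact: vact_frame.
Qed.

(* Near [p] the coefficients of [X] solve the linear system whose matrix
   expresses the frame in the chart of [p], which is invertible at [p]. *)
Lemma smooth_fcoefP X : smooth_vf X <-> smooth_row (fcoef X).
Proof.
split=> [SX p j|SX].
  (* [L q] refers to the chart of [q] and need not depend smoothly on [q]; [A q] refers to the chart
     of [p] throughout, and equals [L] at [p]. *)
  pose A q := \matrix_(j, i) vact (E j) (coord p i) q.
  have Ap : A p = L p.
    apply/matrixP => k i; rewrite mxE vact_coordE /frame_vf.
    by rewrite -rowE mxE.
  have SA k i : smooth_fun_at (fun q => A q k i) p.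
    by under eq_fun do rewrite mxE; apply/(smooth_vfP _).1.
  have Au : A p \in unitmx by rewrite Ap.
  have [nA SVA] := smooth_fun_at_invmx Au SA.
  pose b q := \row_i vact X (coord p i) q.
  apply: (@near_smooth_fun_at _ _ _ (fun q => (b q *m invmx (A q)) 0 j)).
    have : \forall q \near p, forall i,
        vact X (coord p i) q = \sum_j fcoef X q 0 j * vact (E j) (coord p i) q.
      by apply: filter_forall => i; exact: near_vact_coord.
    move=> nb; apply: filterS2 nA nb => q Aq bE.
    suff -> : b q = fcoef X q *m A q by rewrite mulmxK.
    apply/rowP => i; rewrite !mxE bE; apply: eq_bigr => k _.
    by congr (_ * _); rewrite mxE.
  under eq_fun do rewrite mxE.
  apply: smooth_fun_at_sum => k; apply: smooth_fun_atM => //.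
  by under eq_fun do rewrite mxE; apply/(smooth_vfP _).1.
apply/smooth_vfP => p i.
apply: (near_smooth_fun_at (filterS _ (near_vact_coord X p i))).
  by move=> q; exact: esym.
apply: smooth_fun_at_sum => j; apply: smooth_fun_atM => //.
by apply/(smooth_vfP _).1.
Qed.

Lemma smooth_fcoef X : smooth_vf X -> smooth_row (fcoef X).
Proof. exact: (smooth_fcoefP X).1. Qed.

Lemma smooth_frame y : smooth_row y -> smooth_vf (fun p => y p *m L p).
Proof. by move=> Sy; apply/smooth_fcoefP; rewrite fcoef_frame. Qed.

(** Writing Y f as the sum of Y_j E_j f, the Leibniz rule splits X (Y f) into the terms X(Y_j) E_j f
    and X_i Y_j E_i E_j f. Skew-symmetrising, the latter give the brackets of frame fields. *)
Lemma lie_bracket_expansion X Y p : smooth_vf X -> smooth_vf Y ->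
  lie_bracket X Y p =
  (row_act X (fcoef Y) p - row_act Y (fcoef X) p) *m L p
  + \sum_i \sum_j
      (fcoef X p 0 i * fcoef Y p 0 j) *: lie_bracket (E i) (E j) p.
Proof.
have second_order X' Y' k : smooth_vf Y' ->
    vact X' (vact Y' (coord p k)) p = (row_act X' (fcoef Y') p *m L p) 0 k
      + \sum_i \sum_j (fcoef X' p 0 i * fcoef Y' p 0 j)
                      * vact (E i) (vact (E j) (coord p k)) p.
  move=> SY'; rewrite (near_vact _ (near_vact_coord _ _ _)).
  have Sc j : smooth_fun_at (vact (E j) (coord p k)) p.
    exact/(smooth_vfP _).1.
  have Sy j := smooth_fcoef SY' p j.
  rewrite vact_sum => [|j]; last exact: smooth_fun_atM (Sy j) (Sc j).
  rewrite [in RHS]mxE exchange_big -big_split; apply: eq_bigr => j _ /=.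
  rewrite (vactM X' (Sy j) (Sc j)) addrC mxE vact_coordE /frame_vf.
  rewrite -rowE [row _ _ _ _]mxE [row_act _ _ _ _ _]mxE; congr (_ + _).
  rewrite (vact_frame X'); last first.
    exact: nbhs_singleton (smooth_fun_at_differentiable (Sc j)).
  by rewrite mulr_sumr; apply: eq_bigr => i _; ring.
move=> SX SY; apply/rowP => k; rewrite [LHS]mxE !second_order // mulmxBl.
rewrite [RHS]mxE summxE [X in _ = X + _]mxE.
rewrite [X in _ - (_ + X)]exchange_big /=.
under [X in _ = _ + X]eq_bigr do rewrite summxE.
rewrite opprD addrACA [X in _ = _ + X + _]mxE; congr (_ + _).
rewrite -sumrB; apply: eq_bigr => i _.
rewrite -sumrB; apply: eq_bigr => j _.
rewrite [RHS]mxE /lie_bracket [X in _ = _ * X]mxE mulrBr.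
by rewrite [fcoef Y p 0 j * _]mulrC.
Qed.

(** * Brackets and contact metric tensors in a frame with constant structure *)

Variable br : 'rV[R]_n -> 'rV[R]_n -> 'rV[R]_n.
Hypothesis br_frame :
  forall u v, frame_vf (br u v) = lie_bracket (frame_vf u) (frame_vf v).

(** The double sum in the expansion depends only on the coefficients at [p]. It is therefore the
    same for the frame fields with these constant coefficients, whose derivative terms vanish and
    whose bracket is given by [br]. *)
Lemma fcoef_lie_bracket X Y : smooth_vf X -> smooth_vf Y ->
  fcoef (lie_bracket X Y) =
  fun p => row_act X (fcoef Y) p - row_act Y (fcoef X) p
           + br (fcoef X p) (fcoef Y p).
Proof.
move=> SX SY; apply/funext => p; rewrite /fcoef lie_bracket_expansion //.
rewrite mulmxDl mulmxK //; congr (_ + _).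
apply: (can_inj (mulmxK (L_unit p))); rewrite mulmxKV //.
rewrite (_ : br _ _ *m L p
  = lie_bracket (frame_vf (fcoef X p)) (frame_vf (fcoef Y p)) p); last first.
  by rewrite -br_frame.
rewrite (lie_bracket_expansion p (L_smooth _) (L_smooth _)).
by rewrite !fcoef_frame_vf !row_act_cst subrr mul0mx add0r.
Qed.

Lemma lie_bracketE X Y p : smooth_vf X -> smooth_vf Y ->
  lie_bracket X Y p =
  (row_act X (fcoef Y) p - row_act Y (fcoef X) p
   + br (fcoef X p) (fcoef Y p)) *m L p.
Proof. by move=> SX SY; rewrite -[LHS]fcoefK fcoef_lie_bracket. Qed.

Lemma smooth_frame_endo P : smooth_endo (frame_endo P).
Proof.
move=> X /smooth_fcoef SX; apply/smooth_fcoefP; rewrite fcoef_endo.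
exact: smooth_row_mul.
Qed.

(** The derivatives of the coefficients in X(eta(Y)) - Y(eta(X)) are exactly those contained in
    eta([X, Y]). *)
Lemma d_frame_one_form e X Y p : smooth_vf X -> smooth_vf Y ->
  d_one_form (frame_one_form e) X Y p
  = - 2^-1 * (br (fcoef X p) (fcoef Y p) *m e) 0 0.
Proof.
move=> SX SY; rewrite /d_one_form !one_form_on_frame fcoef_lie_bracket //.
have [_ ->] := vact_mul_col e X p (smooth_fcoef SY).
have [_ ->] := vact_mul_col e Y p (smooth_fcoef SX).
by rewrite !mulmxDl mulNmx !mxE; ring.
Qed.

(** Every tangent vector at [p] is [u *m L p] for some row [u], and on such vectors the frame
    tensors take values independent of [p]; the axioms thus become matrix identities. *)
Lemma frame_contact_metric (P Q : 'M[R]_n) (x0 : 'rV[R]_n) (e : 'cV[R]_n) :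
  (forall u v : 'rV_n, (u *m Q *m v^T) 0 0 = (v *m Q *m u^T) 0 0) ->
  (forall u : 'rV_n, u != 0 -> 0 < (u *m Q *m u^T) 0 0) ->
  (x0 *m e) 0 0 = 1 ->
  (forall u : 'rV_n, u *m P *m P = - u + (u *m e) 0 0 *: x0) ->
  (forall u v : 'rV_n, (u *m P *m Q *m (v *m P)^T) 0 0
    = (u *m Q *m v^T) 0 0 - (u *m e) 0 0 * (v *m e) 0 0) ->
  (forall u v : 'rV_n,
    (u *m Q *m (v *m P)^T) 0 0 = - 2^-1 * (br u v *m e) 0 0) ->
  is_contact_metric (frame_endo P) (frame_vf x0) (frame_one_form e)
    (frame_form Q).
Proof.
move=> Qsym Qpos x0e PP PQ dE.
have evE p u v :
    ev_form (frame_form Q) p (u *m L p) (v *m L p) = (u *m Q *m v^T) 0 0.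
  by rewrite /ev_form /frame_form !mulmxA mulmxK // -mulmxA -trmx_mul mulmxK.
have ev1E p u : ev_one_form (frame_one_form e) p (u *m L p) = (u *m e) 0 0.
  by rewrite /ev_one_form /frame_one_form !mulmxA mulmxK.
have PE p (u : 'rV_n) : u *m L p *m frame_endo P p = u *m P *m L p.
  by rewrite /frame_endo !mulmxA mulmxK.
have LK p (u : 'rV_n) : u = u *m invmx (L p) *m L p by rewrite mulmxKV.
split.
- split.
  + exact: smooth_frame_endo.
  + exact: L_smooth.
  + move=> X SX p; rewrite one_form_on_frame.
    by have [] := vact_mul_col e X p (smooth_fcoef SX).
  + split.
    * move=> X Y SX SY p; rewrite form_on_frame.
      by have [] := vact_form Q X p (smooth_fcoef SX) (smooth_fcoef SY).
    * by move=> p u v; rewrite (LK p u) (LK p v) !evE Qsym.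
    * move=> p u u0; rewrite (LK p u) evE Qpos //.
      by apply: contra_neq u0 => u0; rewrite (LK p u) u0 mul0mx.
- by move=> p; rewrite ev1E.
- move=> p u; rewrite (LK p u) !PE PP ev1E mulmxDl mulNmx -scalemxAl.
  by [].
- by move=> p u v; rewrite (LK p u) (LK p v) !PE !evE !ev1E PQ.
- move=> X Y SX SY p.
  by rewrite form_on_frame fcoef_endo d_frame_one_form // dE.
Qed.

(** The constant [P] commutes with [row_act], so the derivative terms of the four brackets cancel in
    pairs. *)
Lemma nijenhuis_frame P X Y p : smooth_vf X -> smooth_vf Y ->
  let x := fcoef X p in let y := fcoef Y p in
  nijenhuis (frame_endo P) X Y p =
  (br x y *m P *m P + br (x *m P) (y *m P) - br (x *m P) y *m P
   - br x (y *m P) *m P) *m L p.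
Proof.
move=> SX SY x y; rewrite -[LHS]fcoefK; congr (_ *m _).
have cX := smooth_fcoef SX; have cY := smooth_fcoef SY.
pose F := endo_on (frame_endo P).
have SFX : smooth_vf (F X) := smooth_frame_endo P SX.
have SFY : smooth_vf (F Y) := smooth_frame_endo P SY.
have FE V : fcoef (F V) = fun q => fcoef V q *m P := fcoef_endo P V.
have coef4 (A B C D : vector_field M) a b c d :
    fcoef A p = a -> fcoef B p = b -> fcoef C p = c -> fcoef D p = d ->
    fcoef (A + B - C - D) p = a + b - c - d.
  by move=> <- <- <- <-; rewrite /fcoef !mulmxDl !mulNmx.
have EA : fcoef (F (F (lie_bracket X Y))) p
    = (row_act X (fcoef Y) p - row_act Y (fcoef X) p + br x y) *m P *m P.
  by rewrite !FE (fcoef_lie_bracket SX SY).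
have EB : fcoef (lie_bracket (F X) (F Y)) p
    = row_act (F X) (fcoef Y) p *m P - row_act (F Y) (fcoef X) p *m P
      + br (x *m P) (y *m P).
  by rewrite (fcoef_lie_bracket SFX SFY) !FE !row_act_mul.
have EC : fcoef (F (lie_bracket (F X) Y)) p
    = (row_act (F X) (fcoef Y) p - row_act Y (fcoef X) p *m P
       + br (x *m P) y) *m P.
  by rewrite FE (fcoef_lie_bracket SFX SY) FE row_act_mul.
have ED : fcoef (F (lie_bracket X (F Y))) p
    = (row_act X (fcoef Y) p *m P - row_act (F Y) (fcoef X) p
       + br x (y *m P)) *m P.
  by rewrite FE (fcoef_lie_bracket SX SFY) FE row_act_mul.
apply: etrans (coef4 _ _ _ _ _ _ _ _ EA EB EC ED) _.
rewrite !(mulmxDl, mulNmx) -/x -/y.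
move: (br x y *m P *m P) (br (x *m P) (y *m P)) => r1 r2.
move: (br (x *m P) y *m P) (br x (y *m P) *m P) => r3 r4.
move: (row_act X (fcoef Y) p *m P *m P) => a.
move: (row_act Y (fcoef X) p *m P *m P) => b.
move: (row_act (F X) (fcoef Y) p *m P) (row_act (F Y) (fcoef X) p *m P) => c d.
apply/rowP => j; rewrite !mxE; ring.
Qed.

(** The coefficients of xi are constant, so each bracket contributes the same derivative of X along
    xi, multiplied by [P], and the two cancel. *)
Lemma h_tensor_frame P x0 X p : smooth_vf X ->
  h_tensor (frame_endo P) (frame_vf x0) X p =
  (2^-1 *: (br x0 (fcoef X p *m P) - br x0 (fcoef X p) *m P)) *m L p.
Proof.
move=> SX; have cX := smooth_fcoef SX.
pose F := endo_on (frame_endo P); pose xi := frame_vf x0.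
have SFX : smooth_vf (F X) := smooth_frame_endo P SX.
have FE V : fcoef (F V) = fun q => fcoef V q *m P := fcoef_endo P V.
have EA : fcoef (lie_bracket xi (F X)) p
    = row_act xi (fcoef X) p *m P + br x0 (fcoef X p *m P).
  rewrite (fcoef_lie_bracket (L_smooth x0) SFX) FE row_act_mul //.
  by rewrite fcoef_frame_vf row_act_cst subr0.
have EB : fcoef (F (lie_bracket xi X)) p
    = row_act xi (fcoef X) p *m P + br x0 (fcoef X p) *m P.
  rewrite FE (fcoef_lie_bracket (L_smooth x0) SX).
  by rewrite fcoef_frame_vf row_act_cst subr0 mulmxDl.
rewrite -[LHS]fcoefK; congr (_ *m _).
have coef2 (A B : vector_field M) a b : fcoef A p = a -> fcoef B p = b ->
    fcoef (fun q => 2^-1 *: (A q - B q)) p = 2^-1 *: (a - b).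
  by move=> <- <-; rewrite /fcoef -scalemxAl mulmxBl.
apply: etrans (coef2 _ _ _ _ EA EB) _; congr (_ *: _).
by rewrite opprD addrACA subrr add0r.
Qed.

(** * Connections with constant Christoffel symbols *)

Variable Gam : 'I_n -> 'M[R]_n.

Definition frame_christoffel (u v : 'rV[R]_n) : 'rV[R]_n :=
  \sum_i u 0 i *: (v *m Gam i).
Local Notation G := frame_christoffel.

Lemma christoffelDl u u' v : G (u + u') v = G u v + G u' v.
Proof.
by rewrite /G -big_split; apply: eq_bigr => i _; rewrite mxE scalerDl.
Qed.

Lemma christoffelDr u v v' : G u (v + v') = G u v + G u v'.
Proof.
by rewrite /G -big_split; apply: eq_bigr => i _; rewrite mulmxDl scalerDr.
Qed.

Lemma christoffelZl r u v : G (r *: u) v = r *: G u v.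
Proof.
by rewrite /G scaler_sumr; apply: eq_bigr => i _; rewrite mxE scalerA.
Qed.

Lemma christoffelZr r u v : G u (r *: v) = r *: G u v.
Proof.
rewrite /G scaler_sumr; apply: eq_bigr => i _.
by rewrite -scalemxAl !scalerA mulrC.
Qed.

Lemma smooth_christoffel y z :
  smooth_row y -> smooth_row z -> smooth_row (fun p => G (y p) (z p)).
Proof.
move=> Sy Sz; apply: smooth_row_sum => i.
by apply: smooth_rowZ; [move=> p; exact: Sy|exact: smooth_row_mul].
Qed.

Definition frame_connection X Y : vector_field M :=
  fun p => (row_act X (fcoef Y) p + G (fcoef X p) (fcoef Y p)) *m L p.

Lemma smooth_row_act X y : smooth_vf X -> smooth_row y ->
  smooth_row (row_act X y).
Proof.
move=> SX Sy p j; rewrite /row_act; under eq_fun do rewrite mxE.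
exact/SX/Sy.
Qed.

Lemma row_act_vfD X Y y p : smooth_row y ->
  row_act (X + Y) y p = row_act X y p + row_act Y y p.
Proof.
move=> Sy; apply/rowP => j; rewrite !mxE.
have df := nbhs_singleton (smooth_fun_at_differentiable (Sy p j)).
by rewrite /vact !deriveE // linearD.
Qed.

Lemma row_act_vfZ f X y p : smooth_row y ->
  row_act (scale_vf f X) y p = f p *: row_act X y p.
Proof.
move=> Sy; apply/rowP => j; rewrite !mxE.
have df := nbhs_singleton (smooth_fun_at_differentiable (Sy p j)).
by rewrite /vact !deriveE // linearZ.
Qed.

Lemma fcoef_connection X Y : fcoef (frame_connection X Y)
  = fun p => row_act X (fcoef Y) p + G (fcoef X p) (fcoef Y p).
Proof. exact: fcoef_frame. Qed.

(** The flat part [row_act] already accounts for all derivatives in the bracket and in X(g(Y, Z));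
    what remains are two conditions on the constant tensor [G], torsion [br] and skewness for
    [Q]. *)
Lemma frame_levi_civita (Q : 'M[R]_n) :
  (forall u v, G u v - G v u = br u v) ->
  (forall u v w, (G u v *m Q *m w^T) 0 0 + (v *m Q *m (G u w)^T) 0 0 = 0) ->
  is_levi_civita (frame_form Q) frame_connection.
Proof.
move=> torsion metric X Y Z SX SY SZ.
have cX := smooth_fcoef SX; have cY := smooth_fcoef SY.
have cZ := smooth_fcoef SZ.
split.
- apply: smooth_frame; apply: smooth_rowD; first exact: smooth_row_act.
  exact: smooth_christoffel.
- split; apply/funext => p; rewrite /frame_connection fcoefD [RHS]/GRing.add /=.
    by rewrite row_act_vfD // christoffelDl addrACA mulmxDl.
  by rewrite row_actD // christoffelDr addrACA mulmxDl.
- move=> f Sf; split; apply/funext => p; rewrite /frame_connection fcoefZ.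
    by rewrite row_act_vfZ // christoffelZl -scalerDr -scalemxAl.
  rewrite row_actZ // christoffelZr -addrA -scalerDr mulmxDl -!scalemxAl.
  by rewrite fcoefK.
- apply/funext => p; rewrite lie_bracketE // -torsion.
  rewrite [LHS]/GRing.add /= {2}/GRing.opp /= /frame_connection -mulmxBl.
  by rewrite opprD addrACA.
- apply/funext => p; rewrite !form_on_frame.
  have [_ ->] := vact_form Q X p cY cZ.
  rewrite [RHS]/GRing.add /= !fcoef_connection.
  have addE (A B : 'M[R]_1) : (A + B) 0 0 = A 0 0 + B 0 0 by rewrite mxE.
  by rewrite !mulmxDl linearD /= mulmxDr !addE addrACA metric addr0.
Qed.

Lemma frame_curvature X Y x0 p : smooth_vf X -> smooth_vf Y ->
  let x := fcoef X p in let y := fcoef Y p in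
  curvature frame_connection X Y (frame_vf x0) p =
  (G x (G y x0) - G y (G x x0) - G (br x y) x0) *m L p.
Proof.
move=> SX SY x y; have cX := smooth_fcoef SX; have cY := smooth_fcoef SY.
(* [T] is the endomorphism sending u to the covariant derivative of xi along u. It is constant,
   hence commutes with [row_act], and the derivative terms of the curvature cancel. *)
pose T := \matrix_i (x0 *m Gam i).
have GT u : G u x0 = u *m T.
  by rewrite mulmx_sum_row; apply: eq_bigr => i _; rewrite rowK.
have nablaE V : fcoef (frame_connection V (frame_vf x0))
    = fun q => fcoef V q *m T.
  apply/funext => q; rewrite fcoef_connection fcoef_frame_vf row_act_cst add0r.
  by rewrite GT.
have nabla2 U V : smooth_vf V ->
    fcoef (frame_connection U (frame_connection V (frame_vf x0))) p
    = row_act U (fcoef V) p *m T + G (fcoef U p) (fcoef V p *m T).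
  by move=> /smooth_fcoef cV; rewrite fcoef_connection nablaE row_act_mul.
have nablaB : fcoef (frame_connection (lie_bracket X Y) (frame_vf x0)) p
    = (row_act X (fcoef Y) p - row_act Y (fcoef X) p + br x y) *m T.
  by rewrite nablaE (fcoef_lie_bracket SX SY).
have coef3 (A B C : vector_field M) a b c :
    fcoef A p = a -> fcoef B p = b -> fcoef C p = c ->
    fcoef (A - B - C) p = a - b - c.
  by move=> <- <- <-; rewrite /fcoef !mulmxDl !mulNmx.
rewrite -[LHS]fcoefK; congr (_ *m _).
apply: etrans (coef3 _ _ _ _ _ _ (nabla2 X Y SY) (nabla2 Y X SX) nablaB) _.
rewrite !mulmxDl mulNmx -!GT -/x -/y.
move: (G (row_act X (fcoef Y) p) x0) (G (row_act Y (fcoef X) p) x0) => a b.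
move: (G x (G y x0)) (G y (G x x0)) (G (br x y) x0) => r1 r2 r3.
apply/rowP => j; rewrite !mxE; ring.
Qed.

End Frame.

(** * Left-invariant frames *)

Section LeftInvariantFrame.
Variables (R : realType) (n : nat) (G : lie_group R n).
Variables (br : 'rV[R]_n -> 'rV[R]_n -> 'rV[R]_n).
Variables (lam : 'rV[R]_n -> vector_field G).
Hypothesis lam_iso : is_lie_algebra_iso br lam.

Definition lie_frame (p : G) : 'M[R]_n := \matrix_i lam (delta_mx 0 i) p.
Local Notation L := lie_frame.

(** The group axioms of the record are one-sided; the right inverse is derived first. *)
Lemma gmulg1 (p : G) : gmul p (gone G) = p.
Proof.
have mulgV (q : G) : gmul q (ginv q) = gone G.
  rewrite -[LHS]gmul1 -{1}(gmulV (ginv q)) -gmulA [gmul (ginv q) _]gmulA gmulV.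
  by rewrite gmul1 gmulV.
by rewrite -(gmulV p) gmulA mulgV gmul1.
Qed.

Lemma lam_frame x : lam x = frame_vf L x.
Proof.
apply/funext => p; have [lamD _ _ _ _] := lam_iso.
have lam0 : lam 0 p = 0.
  by have /eqP := lamD 1 0 0 p; rewrite !scale1r addr0 -subr_eq0 opprD
    addNKr oppr_eq0 => /eqP.
rewrite /frame_vf mulmx_sum_row {1}(row_sum_delta x).
elim: (index_enum _) => [|i s IHs]; first by rewrite !big_nil.
by rewrite !big_cons lamD IHs rowK.
Qed.

Lemma lie_frame_dleft p q x : x *m L (gmul p q) = dleft p q (x *m L q).
Proof.
have [_ _ /(_ x)[_ lamx] _ _] := lam_iso.
by have := lamx p q; rewrite lam_frame.
Qed.

Lemma lie_frame_dleft1 p x : x *m L p = dleft p (gone G) (x *m L (gone G)).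
Proof. by rewrite -lie_frame_dleft gmulg1. Qed.

(** If [lam x] vanishes at [p], translating by the inverse of [p] and then by any [q] shows that it
    vanishes everywhere, so x = 0 by injectivity of [lam]. *)
Lemma lie_frame_unit p : L p \in unitmx.
Proof.
rewrite -row_free_unit; apply/row_freeP.
have [_ lam_inj _ _ _] := lam_iso.
have L_inj (x : 'rV_n) : x *m L p = 0 -> x = 0.
  have dleft0 q r : dleft q r (0 : 'rV[R]_n) = 0 :> 'rV[R]_n.
    exact: derive0.
  move=> xLp; apply: lam_inj; rewrite !lam_frame; apply/funext => q.
  rewrite /frame_vf mul0mx lie_frame_dleft1 -(gmulV p) lie_frame_dleft xLp.
  by rewrite !dleft0.
have Lfree : row_free (L p).
  by rewrite -kermx_eq0; apply/rowV0P => x /sub_kermxP /L_inj.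
exact/row_freeP.
Qed.

Lemma lie_frame_smooth x : smooth_vf (frame_vf L x).
Proof. by have [_ _ /(_ x)[+ _] _ _] := lam_iso; rewrite lam_frame. Qed.

Lemma lie_frame_bracket x y :
  frame_vf L (br x y) = lie_bracket (frame_vf L x) (frame_vf L y).
Proof. by have [_ _ _ _] := lam_iso; rewrite -!lam_frame. Qed.

Lemma left_invariant_frame_form Q : left_invariant_form (frame_form L Q).
Proof.
move=> p q u v.
have evE r x y :
    ev_form (frame_form L Q) r (x *m L r) (y *m L r) = (x *m Q *m y^T) 0 0.
  rewrite /ev_form /frame_form !mulmxA (mulmxK (lie_frame_unit r)) -mulmxA.
  by rewrite -trmx_mul (mulmxK (lie_frame_unit r)).
rewrite -(mulmxKV (lie_frame_unit q) u) -(mulmxKV (lie_frame_unit q) v).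
by rewrite -!lie_frame_dleft !evE.
Qed.

Lemma ev_frame_form_lam Q p x y :
  ev_form (frame_form L Q) p (lam x p) (lam y p) = (x *m Q *m y^T) 0 0.
Proof.
have Lu := lie_frame_unit p; rewrite !lam_frame /ev_form /frame_form /frame_vf.
by rewrite !mulmxA (mulmxK Lu) -mulmxA -trmx_mul (mulmxK Lu).
Qed.

(** Left translation from the identity to [p] carries the frame to the frame, so an invariant tensor
    has the same matrix in the frame at every point. *)
Lemma left_invariant_structure_frame phi0 xi0 eta0 g0 (P Q : 'M[R]_n)
    (e : 'cV[R]_n) (phi : endo_field G) xi eta (g : form_field G) :
  is_left_invariant_structure lam phi0 xi0 eta0 g0 phi xi eta g ->
  (forall x, phi0 x = x *m P) -> (forall x, eta0 x = (x *m e) 0 0) ->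
  (forall x y, g0 x y = (x *m Q *m y^T) 0 0) ->
  [/\ phi = frame_endo L P, xi = frame_vf L xi0, eta = frame_one_form L e
    & g = frame_form L Q].
Proof.
move=> [[phiL xiL etaL gL] phi1 xi1 eta1 g1] phi0E eta0E g0E.
split; apply/funext => p; have Lu := lie_frame_unit p.
- have PL (x : 'rV_n) : x *m L p *m phi p = x *m P *m L p.
    have := phiL p (gone G) (x *m L (gone G)).
    rewrite -lie_frame_dleft gmulg1 => ->.
    by have := phi1 x; rewrite !lam_frame /frame_vf phi0E => ->;
      rewrite -lie_frame_dleft1.
  rewrite /frame_endo -mulmxA; apply: (canRL (mulKmx Lu)).
  by apply/row_matrixP => i; rewrite !rowE !mulmxA PL.
- by have := xiL p (gone G); rewrite gmulg1 xi1 lam_frame /frame_vf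
    -lie_frame_dleft1.
- rewrite /frame_one_form; apply: (canRL (mulKmx Lu)).
  apply/row_matrixP => i; rewrite !rowE mulmxA lie_frame_dleft1.
  have := etaL p (gone G) (delta_mx 0 i *m L (gone G)).
  have := eta1 (delta_mx 0 i); rewrite eta0E lam_frame gmulg1 /frame_vf => -> E.
  by apply/matrixP => j k; rewrite !ord1.
- have gE (x y : 'rV_n) : ev_form g p (x *m L p) (y *m L p)
      = ev_form (frame_form L Q) p (x *m L p) (y *m L p).
    have := ev_frame_form_lam Q p x y; rewrite !lam_frame => ->.
    have := gL p (gone G) (x *m L (gone G)) (y *m L (gone G)).
    rewrite -!lie_frame_dleft1 gmulg1 => ->.
    by have := g1 x y; rewrite !lam_frame => ->.
  apply/matrixP => i j.
  pose d k : 'rV[R]_n := delta_mx 0 k.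
  have evE (A : 'M[R]_n) : A i j = (d i *m A *m (d j)^T) 0 0.
    by rewrite -rowE trmx_delta -colE !mxE.
  rewrite (evE (g p)) (evE (frame_form L Q p)).
  have := gE (d i *m invmx (L p)) (d j *m invmx (L p)).
  by rewrite !(mulmxKV Lu).
Qed.

End LeftInvariantFrame.

(** * The five-dimensional algebra *)

Section Rows5.
Variable R : realType.

(** With explicit entries, [congr row5] splits an identity between rows into five scalar ones,
    within reach of [ring] and [field]. *)
Definition row5 (x1 x2 x3 x4 x5 : R) : 'rV[R]_5 :=
  \row_i [:: x1; x2; x3; x4; x5]`_i.

Definition mx5 (r1 r2 r3 r4 r5 : 'rV[R]_5) : 'M[R]_5 :=
  \matrix_i [:: r1; r2; r3; r4; r5]`_i.

Lemma row5P (x : 'rV[R]_5) : exists x1 x2 x3 x4 x5, x = row5 x1 x2 x3 x4 x5.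
Proof.
exists (x 0 (inord 0)), (x 0 (inord 1)), (x 0 (inord 2)), (x 0 (inord 3)),
  (x 0 (inord 4)).
apply/rowP => i; rewrite mxE -[in LHS](inord_val i).
by case: i => -[|[|[|[|[|]]]]].
Qed.

Lemma row5D x1 x2 x3 x4 x5 y1 y2 y3 y4 y5 :
  row5 x1 x2 x3 x4 x5 + row5 y1 y2 y3 y4 y5
  = row5 (x1 + y1) (x2 + y2) (x3 + y3) (x4 + y4) (x5 + y5).
Proof. by apply/rowP => -[[|[|[|[|[|]]]]]] //= i5; rewrite !mxE. Qed.

Lemma row5Z a x1 x2 x3 x4 x5 :
  a *: row5 x1 x2 x3 x4 x5 = row5 (a * x1) (a * x2) (a * x3) (a * x4) (a * x5).
Proof. by apply/rowP => -[[|[|[|[|[|]]]]]] //= i5; rewrite !mxE. Qed.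

Lemma row5N x1 x2 x3 x4 x5 :
  - row5 x1 x2 x3 x4 x5 = row5 (- x1) (- x2) (- x3) (- x4) (- x5).
Proof. by apply/rowP => -[[|[|[|[|[|]]]]]] //= i5; rewrite !mxE. Qed.

Lemma row5_0 : 0 = row5 0 0 0 0 0.
Proof. by apply/rowP => -[[|[|[|[|[|]]]]]] //= i5; rewrite !mxE. Qed.

Lemma row5_mul x1 x2 x3 x4 x5 r1 r2 r3 r4 r5 :
  row5 x1 x2 x3 x4 x5 *m mx5 r1 r2 r3 r4 r5
  = x1 *: r1 + x2 *: r2 + x3 *: r3 + x4 *: r4 + x5 *: r5.
Proof.
by rewrite mulmx_sum_row !big_ord_recl big_ord0 !rowK !mxE addr0 !addrA.
Qed.

Lemma row5_dot x1 x2 x3 x4 x5 y1 y2 y3 y4 y5 :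
  (row5 x1 x2 x3 x4 x5 *m (row5 y1 y2 y3 y4 y5)^T) 0 0
  = x1 * y1 + x2 * y2 + x3 * y3 + x4 * y4 + x5 * y5.
Proof. by rewrite mxE !big_ord_recl big_ord0 !mxE addr0 !addrA. Qed.

Lemma coord5_row5 x1 x2 x3 x4 x5 k : (0 < k <= 5)%N ->
  coord5 (row5 x1 x2 x3 x4 x5) k = [:: x1; x2; x3; x4; x5]`_k.-1.
Proof. by case: k => [//|k] /= k5; rewrite /coord5 mxE inordK. Qed.

Lemma basis5_row5 k : (0 < k <= 5)%N ->
  basis5 R k = row5 (k == 1)%N%:R (k == 2)%N%:R (k == 3)%N%:R (k == 4)%N%:R
                    (k == 5)%N%:R.
Proof.
case: k => [//|k] k5; apply/rowP => j; rewrite !mxE eqxx /= -val_eqE /=.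
rewrite inordK //.
by move: k k5 => [|[|[|[|[|]]]]] //= _; case: j => -[|[|[|[|[|]]]]].
Qed.

Definition row5E := (row5D, row5Z, row5N).

Lemma bracket5_row5 x1 x2 x3 x4 x5 y1 y2 y3 y4 y5 :
  let s := Num.sqrt 2 : R in
  bracket5 (row5 x1 x2 x3 x4 x5) (row5 y1 y2 y3 y4 y5) =
  row5 0 (s * (x1 * y2 - x2 * y1))
    (- s * (x2 * y4 - x4 * y2) + (x4 * y5 - x5 * y4))
    (s * (x2 * y3 - x3 * y2) - (x3 * y5 - x5 * y3))
    (- 2 * (x1 * y2 - x2 * y1) - 2 * (x3 * y4 - x4 * y3)).
Proof.
move=> s; rewrite /bracket5 unlock /= !coord5_row5 //= -/s.
rewrite !basis5_row5 //= row5_0 !row5E.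
by congr row5; ring.
Qed.

Lemma phi5_row5 x1 x2 x3 x4 x5 :
  phi5 (row5 x1 x2 x3 x4 x5) = row5 x2 (- x1) x4 (- x3) 0.
Proof.
rewrite /phi5 !coord5_row5 //= !basis5_row5 //= !row5E.
by congr row5; ring.
Qed.

Lemma xi5_row5 : xi5 R = row5 0 0 0 0 1.
Proof. by rewrite /xi5 basis5_row5. Qed.

Lemma eta5_row5 x1 x2 x3 x4 x5 : eta5 (row5 x1 x2 x3 x4 x5) = x5.
Proof. by rewrite /eta5 coord5_row5. Qed.

Lemma metric5_row5 x1 x2 x3 x4 x5 y1 y2 y3 y4 y5 :
  metric5 (row5 x1 x2 x3 x4 x5) (row5 y1 y2 y3 y4 y5)
  = x1 * y1 + x2 * y2 + x3 * y3 + x4 * y4 + x5 * y5.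
Proof. by rewrite /metric5 unlock /= !coord5_row5 //= addr0 !addrA. Qed.

(* On ker eta = C^2, with coordinates x_1 + i x_2 and x_3 + i x_4, phi is
   multiplication by -i and ad xi is diag(0, i).  For h^2 to be a multiple of
   phi^2, the conjugation that fixes d_+ and negates d_- must interchange the
   two coordinate lines. *)
Definition Dplus5 : {vspace 'rV[R]_5} :=
  (<[row5 1 0 1 0 0]> + <[row5 0 1 0 (-1) 0]>)%VS.
Definition Dminus5 : {vspace 'rV[R]_5} :=
  (<[row5 1 0 (-1) 0 0]> + <[row5 0 1 0 1 0]>)%VS.

Lemma Dplus5P x : x \in Dplus5 -> exists a b, x = row5 a b a (- b) 0.
Proof.
move=> /memv_addP[_ /vlineP[a ->]] [_ /vlineP[b ->]] ->; exists a, b.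
by rewrite !row5E; congr row5; ring.
Qed.

Lemma Dminus5P x : x \in Dminus5 -> exists a b, x = row5 a b (- a) b 0.
Proof.
move=> /memv_addP[_ /vlineP[a ->]] [_ /vlineP[b ->]] ->; exists a, b.
by rewrite !row5E; congr row5; ring.
Qed.

Lemma orthogonal_decomposition5 : is_orthogonal_decomposition Dplus5 Dminus5.
Proof.
have full : (Dplus5 + Dminus5 + <[xi5 R]>)%VS = fullv.
  apply/eqP; rewrite eqEsubv subvf; apply/subvP => x _.
  have [x1 [x2 [x3 [x4 [x5 ->]]]]] := row5P x.
  pose u1 := row5 1 0 1 0 0; pose u2 := row5 0 1 0 (-1) 0.
  pose u3 := row5 1 0 (-1) 0 0; pose u4 := row5 0 1 0 1 0.
  have -> : row5 x1 x2 x3 x4 x5 =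
      (((x1 + x3) / 2) *: u1 + ((x2 - x4) / 2) *: u2)
      + (((x1 - x3) / 2) *: u3 + ((x2 + x4) / 2) *: u4) + x5 *: xi5 R.
    by rewrite xi5_row5 !row5E; congr row5; field.
  by rewrite !memv_add ?memvZ ?memv_line.
split=> //.
(* Directness by counting: the summands have dimensions at most 2, 2 and 1, and their sum has
   dimension 5. *)
- have dim2 (u v : 'rV[R]_5) : (\dim (<[u]> + <[v]>)%VS <= 2)%N.
    apply: leq_trans (dimv_add_leqif _ _) _.
    by rewrite !dim_vline; do 2 case: eqP.
  rewrite directvE /= eqn_leq; apply/andP; split.
    apply: leq_trans (dimv_add_leqif _ _) _.
    by rewrite leq_add2r; exact: dimv_add_leqif.
  rewrite full dimvf [dim _]mul1n.
  apply: (@leq_trans (2 + 2 + 1)) => //.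
  by rewrite !leq_add ?dim2 // dim_vline; case: eqP.
- move=> _ _ /Dplus5P[a [b ->]] /Dminus5P[a' [b' ->]].
  by rewrite metric5_row5; ring.
- move=> _ /Dplus5P[a [b ->]]; rewrite xi5_row5 metric5_row5; ring.
- move=> _ /Dminus5P[a [b ->]]; rewrite xi5_row5 metric5_row5; ring.
Qed.

(** * Polynomial identities for the deformed tensors *)

Section Deformation.
Variables (c d : R).
Hypothesis cd : c ^+ 2 = 1 + d ^+ 2.
Let s : R := Num.sqrt 2.

(* Matrices act on rows, so the [i]-th row is the image of e_i.  The pair
   (c, d) = (1, 0) gives the given Sasakian structure. *)
Definition phi_mx : 'M[R]_5 :=
  mx5 (row5 0 (- c) 0 d 0) (row5 c 0 d 0 0) (row5 0 d 0 (- c) 0)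
      (row5 d 0 c 0 0) 0.

Definition metric_mx : 'M[R]_5 :=
  mx5 (row5 c 0 (- d) 0 0) (row5 0 c 0 d 0) (row5 (- d) 0 c 0 0)
      (row5 0 d 0 c 0) (row5 0 0 0 0 1).

(* Christoffel symbols, from the Koszul formula: row [j] of the [i]-th matrix
   is the covariant derivative of e_j along e_i. *)
Definition christoffel_mx (i : 'I_5) : 'M[R]_5 :=
  let A := d ^+ 2 / 2 + c in let B := - d - c * d / 2 in
  [:: mx5 0 (row5 0 0 0 0 (- 1)) 0 (row5 0 0 0 0 (d / 2)) (row5 0 A 0 B 0);
      mx5 (row5 0 (- s) 0 0 1) (row5 s 0 0 0 0) (row5 0 0 0 s (d / 2))
          (row5 0 0 (- s) 0 0) (row5 (- A) 0 B 0 0);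
      mx5 0 (row5 0 0 0 0 (d / 2)) 0 (row5 0 0 0 0 (- 1)) (row5 0 B 0 A 0);
      mx5 (row5 0 0 0 0 (d / 2)) 0 (row5 0 0 0 0 1) 0 (row5 B 0 (- A) 0 0);
      mx5 (row5 0 A 0 B 0) (row5 (- A) 0 B 0 0) (row5 0 B 0 (1 + A) 0)
          (row5 B 0 (- 1 - A) 0 0) 0]`_i.

Lemma phi_mx_row5 x1 x2 x3 x4 x5 : row5 x1 x2 x3 x4 x5 *m phi_mx =
  row5 (c * x2 + d * x4) (- c * x1 + d * x3) (d * x2 + c * x4)
       (d * x1 - c * x3) 0.
Proof. by rewrite row5_mul row5_0 !row5E; congr row5; ring. Qed.

Lemma metric_mx_row5 x1 x2 x3 x4 x5 : row5 x1 x2 x3 x4 x5 *m metric_mx =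
  row5 (c * x1 - d * x3) (c * x2 + d * x4) (- d * x1 + c * x3)
       (d * x2 + c * x4) x5.
Proof. by rewrite row5_mul !row5E; congr row5; ring. Qed.

(** The covariant derivative of xi along X is - phi X - phi h X. For X = e_1, where h e_1 = - (d /
    2) e_3, this is A e_2 + B e_4, which explains the constants [A] and [B]. *)
Lemma christoffel_row5 x1 x2 x3 x4 x5 y1 y2 y3 y4 y5 :
  let A := d ^+ 2 / 2 + c in let B := - d - c * d / 2 in
  frame_christoffel christoffel_mx (row5 x1 x2 x3 x4 x5) (row5 y1 y2 y3 y4 y5) =
  row5 (s * x2 * y2 - A * x2 * y5 + B * x4 * y5 - A * x5 * y2 + B * x5 * y4)
    (A * x1 * y5 - s * x2 * y1 + B * x3 * y5 + A * x5 * y1 + B * x5 * y3)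
    (- s * x2 * y4 + B * x2 * y5 - A * x4 * y5 + B * x5 * y2
     - (1 + A) * x5 * y4)
    (B * x1 * y5 + s * x2 * y3 + A * x3 * y5 + B * x5 * y1 + (1 + A) * x5 * y3)
    (- x1 * y2 + d / 2 * x1 * y4 + x2 * y1 + d / 2 * x2 * y3 + d / 2 * x3 * y2
     - x3 * y4 + d / 2 * x4 * y1 + x4 * y3).
Proof.
move=> A B; rewrite /frame_christoffel !big_ord_recl big_ord0 !mxE /=.
rewrite /christoffel_mx /= -/A -/B !row5_mul row5_0 !row5E.
by congr row5; ring.
Qed.

Lemma metric_mx_sym (u v : 'rV[R]_5) :
  (u *m metric_mx *m v^T) 0 0 = (v *m metric_mx *m u^T) 0 0.
Proof.
have [x1 [x2 [x3 [x4 [x5 ->]]]]] := row5P u.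
have [y1 [y2 [y3 [y4 [y5 ->]]]]] := row5P v.
by rewrite !metric_mx_row5 !row5_dot; ring.
Qed.

(** Multiply by c and complete the squares: c^2 - d^2 = 1 leaves x_3^2 and x_4^2 with coefficient
    1. *)
Lemma metric_mx_pos (u : 'rV[R]_5) : 0 < c -> u != 0 ->
  0 < (u *m metric_mx *m u^T) 0 0.
Proof.
move=> c0; have [x1 [x2 [x3 [x4 [x5 ->]]]]] := row5P u.
rewrite metric_mx_row5 row5_dot => u0.
set q := (X in 0 < X).
have qE : c * q = (c * x1 - d * x3) ^+ 2 + x3 ^+ 2 + (c * x2 + d * x4) ^+ 2
    + x4 ^+ 2 + c * x5 ^+ 2.
  by rewrite /q; ring: cd.
rewrite -(pmulr_rgt0 _ c0) qE ltNge; apply: contra u0 => le0.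
have g1 := sqr_ge0 (c * x1 - d * x3); have g2 := sqr_ge0 (c * x2 + d * x4).
have g3 := sqr_ge0 x3; have g4 := sqr_ge0 x4.
have g5 : 0 <= c * x5 ^+ 2 by rewrite mulr_ge0 ?sqr_ge0 // ltW.
have x30 : x3 = 0 by apply/eqP; rewrite -sqrf_eq0; apply/eqP; lra.
have x40 : x4 = 0 by apply/eqP; rewrite -sqrf_eq0; apply/eqP; lra.
have x50 : c * x5 ^+ 2 = 0 by lra.
have E1 : (c * x1 - d * x3) ^+ 2 = 0 by lra.
have E2 : (c * x2 + d * x4) ^+ 2 = 0 by lra.
move: E1 E2 x50; rewrite x30 x40 !mulr0 subr0 addr0 => /eqP + /eqP + /eqP.
rewrite !sqrf_eq0 !mulf_eq0 (gt_eqF c0) row5_0 /= orbb.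
by move=> /eqP -> /eqP -> /eqP ->.
Qed.

Lemma phi_mx_sqr (u : 'rV[R]_5) :
  u *m phi_mx *m phi_mx = - u + (u *m (xi5 R)^T) 0 0 *: xi5 R.
Proof.
have [x1 [x2 [x3 [x4 [x5 ->]]]]] := row5P u.
rewrite !phi_mx_row5 xi5_row5 row5_dot !row5E.
by congr row5; ring: cd.
Qed.

Lemma phi_mx_isometry (u v : 'rV[R]_5) :
  (u *m phi_mx *m metric_mx *m (v *m phi_mx)^T) 0 0
  = (u *m metric_mx *m v^T) 0 0
    - (u *m (xi5 R)^T) 0 0 * (v *m (xi5 R)^T) 0 0.
Proof.
have [x1 [x2 [x3 [x4 [x5 ->]]]]] := row5P u.
have [y1 [y2 [y3 [y4 [y5 ->]]]]] := row5P v.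
by rewrite !phi_mx_row5 xi5_row5 !metric_mx_row5 !row5_dot; ring: cd.
Qed.

(** The right-hand side does not involve c and d, and the metric is nondegenerate: this equation is
    what determines [phi_mx] from [metric_mx]. *)
Lemma metric_mx_phi (u v : 'rV[R]_5) :
  (u *m metric_mx *m (v *m phi_mx)^T) 0 0
  = - 2^-1 * (bracket5 u v *m (xi5 R)^T) 0 0.
Proof.
have [x1 [x2 [x3 [x4 [x5 ->]]]]] := row5P u.
have [y1 [y2 [y3 [y4 [y5 ->]]]]] := row5P v.
rewrite !phi_mx_row5 xi5_row5 !metric_mx_row5 bracket5_row5 !row5_dot.
by field: cd.
Qed.

Local Notation Gam := (frame_christoffel christoffel_mx).

Lemma christoffel_torsion (u v : 'rV[R]_5) : Gam u v - Gam v u = bracket5 u v.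
Proof.
have [x1 [x2 [x3 [x4 [x5 ->]]]]] := row5P u.
have [y1 [y2 [y3 [y4 [y5 ->]]]]] := row5P v.
by rewrite !christoffel_row5 bracket5_row5 -/s !row5E; congr row5; field: cd.
Qed.

Lemma christoffel_metric (u v w : 'rV[R]_5) :
  (Gam u v *m metric_mx *m w^T) 0 0 + (v *m metric_mx *m (Gam u w)^T) 0 0 = 0.
Proof.
have [x1 [x2 [x3 [x4 [x5 ->]]]]] := row5P u.
have [y1 [y2 [y3 [y4 [y5 ->]]]]] := row5P v.
have [z1 [z2 [z3 [z4 [z5 ->]]]]] := row5P w.
by rewrite !christoffel_row5 !metric_mx_row5 !row5_dot; field: cd.
Qed.

(** For u = e_1 and v = xi the left side is (A^2 - B^2) e_1 + B e_3, with [A], [B] from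
    [christoffel_mx], while h e_1 = - (d / 2) e_3. Hence k = A^2 - B^2 = 1 - (d / 2)^2 and, if d is
    nonzero, mu = - 2 B / d = 2 + c. *)
Lemma curvature_kmu (u v : 'rV[R]_5) :
  let h w := 2^-1 *: (bracket5 (xi5 R) (w *m phi_mx)
                      - bracket5 (xi5 R) w *m phi_mx) in
  let eta w := (w *m (xi5 R)^T) 0 0 in
  Gam u (Gam v (xi5 R)) - Gam v (Gam u (xi5 R)) - Gam (bracket5 u v) (xi5 R)
  = (1 - (d / 2) ^+ 2) *: (eta v *: u - eta u *: v)
    + (2 + c) *: (eta v *: h u - eta u *: h v).
Proof.
have [x1 [x2 [x3 [x4 [x5 ->]]]]] := row5P u.
have [y1 [y2 [y3 [y4 [y5 ->]]]]] := row5P v.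
move=> h eta; rewrite /h /eta xi5_row5 !phi_mx_row5 !bracket5_row5 !phi_mx_row5.
rewrite !christoffel_row5 !row5_dot -/s !row5E.
have s2 : s ^+ 2 = 2 by rewrite sqr_sqrtr.
by congr row5; field: cd s2.
Qed.

End Deformation.
End Rows5.

(** * Transfer from the Lie algebra to the group *)

Section LeftInvariantStructures.
Variables (R : realType) (G : lie_group R 5) (lam : 'rV[R]_5 -> vector_field G).
Hypothesis lam_iso : is_lie_algebra_iso (@bracket5 R) lam.

Local Notation L := (lie_frame lam).
Local Notation L_unit := (lie_frame_unit lam_iso).
Local Notation L_smooth := (lie_frame_smooth lam_iso).
Local Notation L_bracket := (lie_frame_bracket lam_iso).
Local Notation xi := (frame_vf L (xi5 R)).
Local Notation eta := (frame_one_form L (xi5 R)^T).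

Lemma deformed_contact_metric (c d : R) : 0 < c -> c ^+ 2 = 1 + d ^+ 2 ->
  is_contact_metric (frame_endo L (phi_mx c d)) xi eta
    (frame_form L (metric_mx c d)).
Proof.
move=> c0 cd; apply: (frame_contact_metric L_unit L_smooth L_bracket).
- exact: metric_mx_sym.
- by move=> u; exact: metric_mx_pos.
- by rewrite xi5_row5 row5_dot; ring.
- exact: phi_mx_sqr.
- exact: phi_mx_isometry.
- exact: metric_mx_phi.
Qed.

Lemma undeformed_sasakian :
  is_sasakian (frame_endo L (phi_mx 1 0)) xi eta (frame_form L (metric_mx 1 0)).
Proof.
split=> [|X Y SX SY p].
  by apply: deformed_contact_metric; rewrite ?ltr01 //; ring.
rewrite (nijenhuis_frame L_unit L_smooth L_bracket (phi_mx 1 0) p SX SY) /=.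
rewrite (d_frame_one_form L_unit L_smooth L_bracket _ p SX SY).
rewrite /frame_vf scalemxAl; congr (_ *m _).
have [x1 [x2 [x3 [x4 [x5 ->]]]]] := row5P (fcoef L X p).
have [y1 [y2 [y3 [y4 [y5 ->]]]]] := row5P (fcoef L Y p).
rewrite !(phi_mx_row5, bracket5_row5) xi5_row5 row5_dot !row5E.
by congr row5; field.
Qed.

(* The Nijenhuis condition already fails on the pair (e_1, xi). *)
Lemma deformed_not_sasakian (c d : R) : d != 0 ->
  ~ is_sasakian (frame_endo L (phi_mx c d)) xi eta
      (frame_form L (metric_mx c d)).
Proof.
move=> d0 [_ nij]; pose e1 := row5 1 0 0 0 0 : 'rV[R]_5.
have := nij _ _ (L_smooth e1) (L_smooth (xi5 R)) (gone G).
rewrite (nijenhuis_frame L_unit L_smooth L_bracket (phi_mx c d) (gone G)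
  (L_smooth e1) (L_smooth (xi5 R))) /=.
rewrite (d_frame_one_form L_unit L_smooth L_bracket _ (gone G)
  (L_smooth e1) (L_smooth (xi5 R))).
rewrite !(fcoef_frame_vf L_unit) /cst /frame_vf scalemxAl.
move=> /(can_inj (mulmxK (L_unit _))).
rewrite /e1 xi5_row5 !(phi_mx_row5, bracket5_row5) row5_dot !row5E.
(* The Nijenhuis tensor on (e_1, xi) is - d^2 e_2 + c d e_4, whereas d eta(e_1, xi) = 0. Index 1,
   counted from 0, is the e_2 coordinate. *)
move=> /rowP/(_ (inord 1)); rewrite !mxE inordK //= => E.
have /eqP : d ^+ 2 = 0 by rewrite -[RHS]oppr0 -[LHS]opprK; congr (- _); lra.
by rewrite sqrf_eq0 (negPf d0).
Qed.

Lemma deformed_kmu (c d : R) : 0 < c -> c ^+ 2 = 1 + d ^+ 2 ->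
  is_contact_metric_kmu (frame_endo L (phi_mx c d)) xi eta
    (frame_form L (metric_mx c d)) (1 - (d / 2) ^+ 2) (2 + c).
Proof.
move=> c0 cd; split; first exact: deformed_contact_metric.
exists (frame_connection L (christoffel_mx c d)).
  apply: (frame_levi_civita L_unit L_smooth L_bracket).
    exact: christoffel_torsion.
  exact: christoffel_metric.
move=> X Y SX SY p h.
rewrite (frame_curvature L_unit L_smooth L_bracket _ _ p SX SY).
rewrite /h !(h_tensor_frame L_unit L_smooth L_bracket _ _ p) //.
rewrite !one_form_on_frame (curvature_kmu cd) -[X p](fcoefK L_unit).
rewrite -[Y p](fcoefK L_unit).
move: (2^-1 *: (_ (fcoef L X p *m _) - _)) => hX.
move: (2^-1 *: (_ (fcoef L Y p *m _) - _)) => hY.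
by rewrite mulmxDl -!scalemxAl !mulmxBl -!scalemxAl.
Qed.

Lemma deformed_boeckx (c d : R) : 0 < c -> 0 < d -> c ^+ 2 = 1 + d ^+ 2 ->
  has_boeckx_invariant (frame_endo L (phi_mx c d)) xi eta
    (frame_form L (metric_mx c d)) (- (c / d)).
Proof.
move=> c0 d0 cd; split; first by apply: deformed_not_sasakian; rewrite gt_eqF.
exists (1 - (d / 2) ^+ 2), (2 + c); split; first exact: deformed_kmu.
- by rewrite ltrBlDr ltrDl exprn_gt0 // divr_gt0.
(* Positivity of d selects d / 2 as the square root of 1 - k, which fixes the sign of the
   invariant. *)
- rewrite subKr sqrtr_sqr gtr0_norm ?divr_gt0 //.
  by field; rewrite gt_eqF.
Qed.

(** The eigenvalues of [metric_mx] are c - d on [Dplus5] and c + d on [Dminus5]. *)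
Lemma deformed_metric_mxE (a c d : R) : c - d = a^-1 -> c + d = a ->
  is_deformed_metric lam eta (frame_form L (metric_mx 1 0))
    (Dplus5 R) (Dminus5 R) a (frame_form L (metric_mx c d)).
Proof.
move=> cBd cDd; split; first exact: left_invariant_frame_form lam_iso _.
- move=> _ _ /Dplus5P[x [y ->]] /Dplus5P[x' [y' ->]].
  rewrite !(ev_frame_form_lam lam_iso) !metric_mx_row5 !row5_dot -cBd; ring.
- move=> _ _ /Dminus5P[x [y ->]] /Dminus5P[x' [y' ->]].
  rewrite !(ev_frame_form_lam lam_iso) !metric_mx_row5 !row5_dot -cDd; ring.
have xiP x : x \in <[xi5 R]>%VS -> exists k, x = row5 0 0 0 0 k.
  move=> /vlineP[k ->]; exists k; rewrite xi5_row5 row5Z.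
  by congr row5; ring.
move=> i j ij x y.
have etaE u : ev_one_form eta (gone G) (lam u (gone G)) = (u *m (xi5 R)^T) 0 0.
  rewrite (lam_frame lam_iso) /ev_one_form /frame_one_form /frame_vf mulmxA.
  by rewrite (mulmxK (L_unit _)).
rewrite !etaE (ev_frame_form_lam lam_iso) xi5_row5.
(* Seven ordered pairs of summands remain; both sides vanish on all of them but the last, where both
   factors lie in the line of xi. *)
case: i ij => -[|[|[|//]]] i3; case: j => -[|[|[|//]]] j3 //= _;
  rewrite /summand /=.
- move=> /Dplus5P[? [? ->]] /Dminus5P[? [? ->]].
  by rewrite metric_mx_row5 !row5_dot; ring.
- move=> /Dplus5P[? [? ->]] /xiP[? ->].
  by rewrite metric_mx_row5 !row5_dot; ring.
- move=> /Dminus5P[? [? ->]] /Dplus5P[? [? ->]].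
  by rewrite metric_mx_row5 !row5_dot; ring.
- move=> /Dminus5P[? [? ->]] /xiP[? ->].
  by rewrite metric_mx_row5 !row5_dot; ring.
- move=> /xiP[? ->] /Dplus5P[? [? ->]].
  by rewrite metric_mx_row5 !row5_dot; ring.
- move=> /xiP[? ->] /Dminus5P[? [? ->]].
  by rewrite metric_mx_row5 !row5_dot; ring.
- move=> /xiP[? ->] /xiP[? ->].
  by rewrite metric_mx_row5 !row5_dot; ring.
Qed.

End LeftInvariantStructures.

Theorem theorem6 (R : realType) (G : lie_group R 5)
    (Gconnected : connected [set: G])
    (lam : 'rV[R]_5 -> vector_field G)
    (lam_iso : is_lie_algebra_iso (@bracket5 R) lam)
    (phi : endo_field G) (xi : vector_field G)
    (eta : one_form G) (g : form_field G)
    (structure : is_left_invariant_structure lam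
       (@phi5 R) (@xi5 R) (@eta5 R) (@metric5 R) phi xi eta g) :
  is_sasakian phi xi eta g /\
  exists Dp Dm : {vspace 'rV[R]_5},
    is_orthogonal_decomposition Dp Dm /\
    forall a : R, 1 < a ->
      exists ga : form_field G,
        [/\ is_deformed_metric lam eta g Dp Dm a ga,
            associated_metric xi eta ga
          & exists phi_a : endo_field G,
              has_boeckx_invariant phi_a xi eta ga
                (- ((a ^+ 2 + 1) / (a ^+ 2 - 1)))].
Proof.
(* The given data are the case (c, d) = (1, 0); eta is the transpose of xi because the basis is
   orthonormal. *)
have [|||-> -> -> ->] := left_invariant_structure_frame lam_iso
  (P := phi_mx 1 0) (Q := metric_mx 1 0) (e := (xi5 R)^T) structure.
- move=> x; have [x1 [x2 [x3 [x4 [x5 ->]]]]] := row5P x.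
  by rewrite phi5_row5 phi_mx_row5; congr row5; ring.
- move=> x; have [x1 [x2 [x3 [x4 [x5 ->]]]]] := row5P x.
  by rewrite eta5_row5 xi5_row5 row5_dot; ring.
- move=> x y; have [x1 [x2 [x3 [x4 [x5 ->]]]]] := row5P x.
  have [y1 [y2 [y3 [y4 [y5 ->]]]]] := row5P y.
  by rewrite metric5_row5 metric_mx_row5 row5_dot; ring.
split; first exact: undeformed_sasakian.
exists (Dplus5 R), (Dminus5 R); split; first exact: orthogonal_decomposition5.
move=> a a1; have a0 : 0 < a := lt_trans ltr01 a1.
have an0 : a != 0 by rewrite gt_eqF.
pose c := (a + a^-1) / 2; pose d := (a - a^-1) / 2.
have c0 : 0 < c by rewrite divr_gt0 // addr_gt0 // invr_gt0.
have d0 : 0 < d.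
  by rewrite divr_gt0 // subr_gt0 (lt_trans _ a1) // invf_lt1.
have cd : c ^+ 2 = 1 + d ^+ 2 by rewrite /c /d; field.
exists (frame_form (lie_frame lam) (metric_mx c d)); split.
- by apply: deformed_metric_mxE => //; rewrite /c /d; field.
- exists (frame_endo (lie_frame lam) (phi_mx c d)).
  exact: deformed_contact_metric.
- exists (frame_endo (lie_frame lam) (phi_mx c d)).
  have -> : (a ^+ 2 + 1) / (a ^+ 2 - 1) = c / d.
    have a2 : a ^+ 2 - 1 != 0.
      by rewrite gt_eqF // subr_gt0 exprn_egt1.
    by rewrite /c /d; field; rewrite an0 -expr2.
  exact: deformed_boeckx.
Qed.
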